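(* For every $K\ge 1$ there exists a constant $C=C(K)>0$, depending only on $K$, such that the following holds. Let $X$ be a mean zero random vector in $\mathbb{R}^n$ with covariance matrix $\Sigma=\mathbb{E}XX^{\mathsf T}$. Suppose that $$\|X\|_2^2\le K\,\mathbb{E}\|X\|_2^2=K\operatorname{tr}\Sigma\quad\text{almost surely}.$$ Then, for every $N\ge1$, $$\mathbb{E}\|\Sigma_N-\Sigma\|\le C\,\|\Sigma\|\left(\sqrt{\frac{n\log n}{N}}+\frac{n\log n}{N}\right),$$ where $\Sigma_N:=\frac1N\sum_{i=1}^N X_iX_i^{\mathsf T}$ is the sample covariance matrix and $X_1,\dots,X_N$ are independent copies of $X$.
   Context: $\|\cdot\|_2$ is the Euclidean norm on $\mathbb{R}^n$, $\|\cdot\|$ is the operator norm of a matrix with respect to the Euclidean norm, and $\operatorname{tr}$ is the trace.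
   Formalization: The dimension is assumed to satisfy n ≥ 2: for n = 1 the right-hand side is 0 because log 1 = 0, while the left-hand side is positive, e.g. for X uniform on {-1,0,1}, K = 3/2, N = 1. *)

(* Defs.v *)
From HB Require Import structures.
From mathcomp Require Import all_boot all_order all_algebra.
From mathcomp Require Import all_classical all_reals all_analysis.

Set Implicit Arguments.
Unset Strict Implicit.
Unset Printing Implicit Defensive.

Import Order.TTheory GRing.Theory Num.Theory.

Local Open Scope classical_set_scope.
Local Open Scope ring_scope.

(* Vectors of R^n are columns ['cV[R]_n]; random vectors take values in
   [n.-tuple R], which carries the product (= Borel) sigma-algebra, matrices
   having no measurable structure in the library. *)
Definition colt (R : realType) (n : nat) (x : n.-tuple R) : 'cV[R]_n :=
  \col_(i < n) tnth x i.

(* The norm [`|v|] of MathComp-Analysis on matrices is the sup norm. *)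
Definition norm2 (R : realType) (n : nat) (v : 'cV[R]_n) : R :=
  Num.sqrt (\sum_(i < n) v i 0 ^+ 2).

Definition opnorm (R : realType) (m n : nat) (A : 'M[R]_(m, n)) : R :=
  sup [set norm2 (A *m v) | v in [set v : 'cV[R]_n | norm2 v <= 1]].

Definition square_integrable (d : measure_display) (T : measurableType d)
    (R : realType) (P : probability T R) (n : nat)
    (X : {RV P >-> n.-tuple R}) : Prop :=
  forall i : 'I_n, (fun t => tnth (X t) i) \in Lfun P 2%:E.

Definition mean_zero (d : measure_display) (T : measurableType d)
    (R : realType) (P : probability T R) (n : nat)
    (X : {RV P >-> n.-tuple R}) : Prop :=
  forall i : 'I_n, ('E_P[fun t => tnth (X t) i] = 0)%E.

(* E[X X^T], entrywise; meaningful for square integrable X, where every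
   expectation below is finite. *)
Definition covmx (d : measure_display) (T : measurableType d)
    (R : realType) (P : probability T R) (n : nat)
    (X : {RV P >-> n.-tuple R}) : 'M[R]_n :=
  \matrix_(i, j) fine ('E_P[fun t => (colt (X t) *m (colt (X t))^T) i j])%E.

Definition sample_covmx (R : realType) (n N : nat) (x : 'I_N -> n.-tuple R) :
    'M[R]_n :=
  N%:R^-1 *: \sum_(i < N) (colt (x i) *m (colt (x i))^T).

Definition identically_distributed
    (d d' d0 : measure_display) (T : measurableType d) (T' : measurableType d')
    (T0 : measurableType d0) (R : realType)
    (P : probability T R) (P' : probability T' R)
    (X : {RV P >-> T0}) (Y : {RV P' >-> T0}) : Prop :=
  forall B : set T0, measurable B -> distribution P X B = distribution P' Y B.

Definition mutually_independent
    (d d0 : measure_display) (T : measurableType d) (T0 : measurableType d0)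
    (R : realType) (P : probability T R) (I : finType)
    (Y : I -> {RV P >-> T0}) : Prop :=
  forall (J : {set I}) (B : I -> set T0), (forall i, measurable (B i)) ->
    P (\bigcap_(i in [set` J]) (Y i @^-1` B i)) =
    (\prod_(i in J) P (Y i @^-1` B i))%E.

Definition independent_copies
    (d d' d0 : measure_display) (T : measurableType d) (T' : measurableType d')
    (T0 : measurableType d0) (R : realType)
    (P : probability T R) (P' : probability T' R) (N : nat)
    (X : {RV P >-> T0}) (Y : 'I_N -> {RV P' >-> T0}) : Prop :=
  mutually_independent Y /\ forall i, identically_distributed X (Y i).

Lemma norm2_sqr (R : realType) (n : nat) (v : 'cV[R]_n) :
  norm2 v ^+ 2 = \sum_(i < n) v i 0 ^+ 2.
Proof. by rewrite /norm2 sqr_sqrtr// sumr_ge0// => i _; exact: sqr_ge0. Qed.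

Lemma expectation_norm2 (d : measure_display) (T : measurableType d)
    (R : realType) (P : probability T R) (n : nat)
    (X : {RV P >-> n.-tuple R}) : square_integrable X ->
  ('E_P[fun t => (norm2 (colt (X t)) ^+ 2)%R] = (\tr (covmx X))%:E)%E.
Proof.
move=> X2.
have sqE i : (fun t => (colt (X t) *m (colt (X t))^T) i i) =
             (fun t => tnth (X t) i ^+ 2).
  by apply/funext => t; rewrite !mxE big_ord1 !mxE expr2.
have X2i i : (fun t => tnth (X t) i ^+ 2) \in Lfun P 1.
  have := Lfun2_mul_Lfun1 (X2 i) (X2 i).
  by congr (_ \in _); apply/funext => t /=; rewrite expr2.
rewrite unlock /mxtrace -sumEFin.
under eq_integral do rewrite norm2_sqr -sumEFin.
rewrite integral_sum//=; last first.
  move=> i; have /Lfun1_integrable := X2i i; apply: eq_integrable => //.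
  by move=> t _; rewrite /= !mxE.
apply: eq_bigr => i _; rewrite mxE sqE fineK ?expectation_fin_num//.
by rewrite unlock; apply: eq_integral => t _; rewrite !mxE.
Qed.

(* Main.v *)
Require Import Defs.
From HB Require Import structures.
From mathcomp Require Import all_boot all_order all_algebra.
From mathcomp Require Import all_classical all_reals all_analysis.
From mathcomp Require Import measurable_realfun zify ring lra.

Set Implicit Arguments.
Unset Strict Implicit.
Unset Printing Implicit Defensive.

Import Order.TTheory GRing.Theory Num.Theory.

Local Open Scope classical_set_scope.
Local Open Scope ring_scope.

(* Let Z_i = X_i X_i^T - Sigma, S = sum_i Z_i, D_i = S - Z_i and
   M = K n ||Sigma||. Since Z_i is centered and independent of D_i,
     E tr S^(2h+2) = sum_i E tr Z_i (S^(2h+1) - D_i^(2h+1))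
                   = sum_i sum_(q <= 2h) E tr (Z_i S^q Z_i D_i^(2h-q)),
   and convexity in q bounds each summand by
   E tr (Z_i^2 S^(2h)) + E tr (Z_i^2 D_i^(2h)). The point of the proof is that
   sum_i Z_i^2 <= 2M (S + N Sigma) + 2N Sigma^2 in the Loewner order, so that
   the first terms are controlled by S itself and no symmetrization is needed;
   in the second ones Z_i^2 may be replaced by its mean, and D_i by S thanks to
   Jensen's inequality. This gives E tr S^(2h+2) <= B E tr S^(2h) for h < p with
   B = 16 p^2 M^2 + 32 p M N ||Sigma||, hence E tr S^(2p) <= n B^p. One concludes
   with ||S||^(2p) <= tr S^(2p) and p of the order of log n. The random vectors
   are truncated to the ball of squared radius M, which changes them on a
   negligible set only. *)

(** * Trace inequalities for powers of symmetric matrices *)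

Section convex_sequence.
Variables (R : realFieldType) (g : nat -> R) (h : nat).
Hypothesis g_convex : forall a, (a.+2 <= h)%N -> 2 * g a.+1 <= g a + g a.+2.

Lemma convex_seq_step a : (a.+1 <= h)%N ->
  a.+1%:R * g a <= g 0%N + a%:R * g a.+1.
Proof.
elim: a => [|a IH] ah; first by rewrite mul1r mul0r addr0.
have := IH (ltnW ah); have := g_convex ah.
have a0 : 0 <= a%:R :> R by [].
rewrite -[a.+2%:R]natr1 -[a.+1%:R]natr1 => g1 g2.
have : (a%:R + 1) * (2 * g a.+1) <= (a%:R + 1) * (g a + g a.+2).
  by rewrite ler_wpM2l// addr_ge0.
lra.
Qed.

End convex_sequence.

(** By induction on the right endpoint: the chord over [[0, h]] is combined with [convex_seq_step]
    at [h], which places [g h] below the chord over [[0, h + 1]]. Denominators are cleared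
    throughout. *)
Lemma convex_seq_chord (R : realFieldType) (g : nat -> R) (h a : nat) :
  (forall b, (b.+2 <= h)%N -> 2 * g b.+1 <= g b + g b.+2) -> (a <= h)%N ->
  h%:R * g a <= (h - a)%:R * g 0%N + a%:R * g h.
Proof.
elim: h => [|h IH] cg ah.
  by move: ah; rewrite leqn0 => /eqP ->; rewrite !mul0r addr0.
move: (ah); rewrite leq_eqVlt => /predU1P[->|].
  by rewrite subnn mul0r add0r.
rewrite ltnS => {}ah.
have [h0|h0] := posnP h.
  by move: ah; rewrite h0 leqn0 => /eqP ->; rewrite subn0 mul0r addr0.
have IHa := IH (fun b hb => cg b (leqW hb)) ah.
have hg := convex_seq_step cg (leqnn h.+1).
have h0R : 0 < h%:R :> R by rewrite ltr0n.
rewrite -(ler_pM2l h0R).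
move: IHa hg; rewrite subSn// -[h.+1%:R]natr1 -[(h - a).+1%:R]natr1 !natrB// => IHa hg.
have : (h%:R + 1) * (h%:R * g a) <=
    (h%:R + 1) * ((h%:R - a%:R) * g 0%N + a%:R * g h) by rewrite ler_wpM2l// addr_ge0.
have : a%:R * ((h%:R + 1) * g h) <= a%:R * (g 0%N + h%:R * g h.+1) by rewrite ler_wpM2l.
lra.
Qed.

Section trace.
Variables (R : realFieldType) (n : nat).
Implicit Types A B S T W Z : 'M[R]_n.

Lemma trmxX A k : (A ^+ k)^T = A^T ^+ k.
Proof.
elim: k => [|k IH]; first by rewrite !expr0 trmx1.
by rewrite exprS exprSr -!mulmxE trmx_mul IH.
Qed.

Lemma mxtrace_mul_tr (m p : nat) (A : 'M[R]_(m, p)) :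
  \tr (A^T *m A) = \sum_j \sum_i A i j ^+ 2.
Proof.
by apply: eq_bigr => j _; rewrite mxE; apply: eq_bigr => i _; rewrite mxE expr2.
Qed.

Lemma mxtrace_mul_tr_ge0 (m p : nat) (A : 'M[R]_(m, p)) : 0 <= \tr (A^T *m A).
Proof.
by rewrite mxtrace_mul_tr; do 2 (apply: sumr_ge0 => ? _); exact: sqr_ge0.
Qed.

Lemma mxtrace_AMGM (m p : nat) (A B : 'M[R]_(m, p)) :
  2 * \tr (A^T *m B) <= \tr (A^T *m A) + \tr (B^T *m B).
Proof.
have := mxtrace_mul_tr_ge0 (A - B).
have -> : \tr ((A - B)^T *m (A - B)) =
    \tr (A^T *m A) + \tr (B^T *m B) - 2 * \tr (A^T *m B).
  rewrite [(A - B)^T]linearB mulmxBl !mulmxBr !raddfB/= -[\tr (B^T *m A)]mxtrace_tr.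
  by rewrite trmx_mul trmxK; ring.
by rewrite subr_ge0.
Qed.

Lemma mxtraceC A B : \tr (A * B) = \tr (B * A).
Proof. by rewrite -!mulmxE mxtrace_mulC. Qed.

Lemma mxtrace_expr2_ge0 A h : A^T = A -> 0 <= \tr (A ^+ (2 * h)).
Proof.
move=> Asym; have := mxtrace_mul_tr_ge0 (A ^+ h).
by rewrite trmxX Asym mulmxE -exprD addnn -mul2n.
Qed.

Section interpolation.
Variables (Z S T : 'M[R]_n) (h : nat).
Hypotheses (Zsym : Z^T = Z) (Ssym : S^T = S) (Tsym : T^T = T).

(* The even values of [phi] are squared Frobenius norms, and Cauchy-Schwarz makes
   them a convex sequence. *)
Let phi q := \tr (Z * S ^+ q * Z * T ^+ (2 * h - q)).

(** With [b = h - a] and [b' = h - a'] the right-hand side is [phi (a + a')], so [phi] becomes a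
    Frobenius inner product to which [mxtrace_AMGM] applies. *)
Lemma mxtrace_cross a b a' b' :
  \tr ((S ^+ a * Z * T ^+ b)^T *m (S ^+ a' * Z * T ^+ b')) =
  \tr (Z * S ^+ (a + a') * Z * T ^+ (b + b')).
Proof.
rewrite -!mulmxE !trmx_mul !mulmxE !trmxX Zsym Ssym Tsym.
have -> : T ^+ b * (Z * S ^+ a) * (S ^+ a' * Z * T ^+ b') =
    T ^+ b * (Z * S ^+ (a + a') * Z * T ^+ b') by rewrite exprD !mulrA.
by rewrite mxtraceC -mulrA -exprD [(b' + b)%N]addnC.
Qed.


Lemma mxtrace_interp_ge0 a : (a <= h)%N -> 0 <= phi a.*2.
Proof.
move=> ah; have := mxtrace_mul_tr_ge0 (S ^+ a * Z * T ^+ (h - a)).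
by rewrite mxtrace_cross !addnn /phi mul2n -doubleB.
Qed.

Lemma mxtrace_interp_AMGM a a' : (a <= h)%N -> (a' <= h)%N ->
  2 * phi (a + a') <= phi a.*2 + phi a'.*2.
Proof.
move=> ah ah'.
have := mxtrace_AMGM (S ^+ a * Z * T ^+ (h - a)) (S ^+ a' * Z * T ^+ (h - a')).
rewrite !mxtrace_cross !addnn /phi mul2n -!doubleB.
by have -> : (h - a + (h - a') = h.*2 - (a + a'))%N by lia.
Qed.

Lemma mxtrace_interp_chord a : (a <= h)%N ->
  h%:R * phi a.*2 <= (h - a)%:R * phi 0%N + a%:R * phi h.*2.
Proof.
move=> ah; apply: (@convex_seq_chord _ (fun a => phi a.*2)) => // b bh.
have := @mxtrace_interp_AMGM b b.+2 (leqW (leqW bh)) bh.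
by have -> : (b + b.+2 = b.+1.*2)%N by lia.
Qed.

(** The chord weights [(h - a) / h] and [a / h] are at most 1, and the even values of [phi] are
    nonnegative. *)
Lemma mxtrace_interp_le a : (a <= h)%N -> phi a.*2 <= phi 0%N + phi h.*2.
Proof.
move=> ah; have [h0|h0] := posnP h.
  move: ah; rewrite h0 leqn0 => /eqP ->; rewrite lerDl -[0%N]/(0%N.*2).
  exact: mxtrace_interp_ge0.
have h0R : 0 < h%:R :> R by rewrite ltr0n.
rewrite -(ler_pM2l h0R) (le_trans (mxtrace_interp_chord ah))// mulrDr lerD// ler_wpM2r// ?ler_nat//.
- exact: (@mxtrace_interp_ge0 0%N).
- exact: leq_subr.
- exact: mxtrace_interp_ge0.
Qed.

(** Even [q] are covered by [mxtrace_interp_le]. At odd [q], where [phi] has no definite sign, it is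
    at most the half-sum of its two even neighbours, each below the same bound. *)
Lemma mxtrace_interpolation q : (q <= 2 * h)%N ->
  \tr (Z * S ^+ q * Z * T ^+ (2 * h - q)) <=
  \tr (Z * Z * S ^+ (2 * h)) + \tr (Z * Z * T ^+ (2 * h)).
Proof.
have -> : \tr (Z * Z * S ^+ (2 * h)) = phi h.*2.
  by rewrite /phi mul2n subnn expr0 mulr1 [RHS]mxtraceC mulrA.
have -> : \tr (Z * Z * T ^+ (2 * h)) = phi 0%N.
  by rewrite /phi subn0 expr0 mulr1.
rewrite -/(phi q) [leRHS]addrC -(odd_double_half q) => qh.
case: (odd q) qh => /= qh; last by rewrite add0n mxtrace_interp_le//; lia.
have h1 : (q./2.+1 <= h)%N by lia.
have := mxtrace_interp_AMGM (ltnW h1) h1.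
have -> : (q./2 + q./2.+1 = 1 + q./2.*2)%N by lia.
have := mxtrace_interp_le h1; have := mxtrace_interp_le (ltnW h1).
lra.
Qed.

End interpolation.

(* The interpolation above with [Z = 1]: tangent inequality for the convex
   function [S |-> tr S^(2h)] at [T]. *)
Lemma mxtrace_Young S T h : S^T = S -> T^T = T -> (0 < h)%N ->
  \tr (T ^+ (2 * h)) + (2 * h)%:R * \tr ((S - T) * T ^+ (2 * h).-1) <=
  \tr (S ^+ (2 * h)).
Proof.
move=> Ss Ts h0; pose phi q := \tr (1 * S ^+ q * 1 * T ^+ (2 * h - q)).
have I1 : (1 : 'M[R]_n)^T = 1 by rewrite trmx1.
(* This bounds [h * phi 2] by [(h - 1) * phi 0 + phi (2 * h)], and the next line bounds [2 * phi 1]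
   by [phi 0 + phi 2]; eliminating [phi 2] gives the claim. *)
have := mxtrace_interp_chord I1 Ss Ts h0.
have := mxtrace_interp_AMGM I1 Ss Ts (leq0n h) h0.
rewrite mulrBl raddfB/=.
have -> : \tr (T * T ^+ (2 * h).-1) = \tr (T ^+ (2 * h)).
  by rewrite -exprS prednK// muln_gt0.
rewrite double0 -[1%N.*2]/2%N -mul2n subnn subn0 !expr0 !mul1r !mulr1 ?mul1r ?add0n expr1.
rewrite -subn1 natrM natrB//.
have : 1 <= h%:R :> R by rewrite ler1n.
set x := h%:R; set a := \tr (S * _); set b := \tr (T ^+ _); set c := \tr (S ^+ 2 * _); set e := \tr (S ^+ _).
nra.
Qed.

Lemma exprB_noncomm S T k :
  S ^+ k.+1 - T ^+ k.+1 = \sum_(q < k.+1) S ^+ q * (S - T) * T ^+ (k - q).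
Proof.
elim: k => [|k IH]; first by rewrite big_ord1 subnn !expr1 !expr0 mul1r mulr1.
rewrite big_ord_recl subn0 expr0 mul1r.
under eq_bigr => i _ do rewrite lift0 subSS exprS -!mulrA.
rewrite -mulr_sumr; under eq_bigr => i _ do rewrite mulrA.
by rewrite -IH mulrBr mulrBl -!exprS [RHS]addrC subrKA.
Qed.

(** Each of the [2h + 1] terms of the telescoping sum [exprB_noncomm] has exponents adding up to the
    even number [2h], as [mxtrace_interpolation] requires. *)
Lemma mxtrace_mul_exprB Z S T h : S = T + Z -> Z^T = Z -> T^T = T ->
  \tr (Z * S ^+ (2 * h).+1) <= \tr (Z * T ^+ (2 * h).+1) +
    (2 * h).+1%:R * (\tr (Z * Z * S ^+ (2 * h)) + \tr (Z * Z * T ^+ (2 * h))).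
Proof.
move=> SE Zs Ts; have Ss : S^T = S by rewrite SE linearD/= Zs Ts.
rewrite -lerBlDl -raddfB/= -mulrBr exprB_noncomm mulr_sumr raddf_sum/=.
have -> : S - T = Z by rewrite SE addrC addKr.
rewrite mulr_natl -[X in _ *+ X](card_ord (2 * h).+1) -sumr_const.
apply: ler_sum => i _; rewrite !mulrA.
by apply: mxtrace_interpolation => //; rewrite -ltnS.
Qed.

End trace.

(** * Trace moments and the operator norm *)

(** [mxtrace_AMGM] for [x *: A] and [y *: B], the scalars being chosen afterwards. *)
Lemma mxtrace_CauchySchwarz (R : realFieldType) (m p : nat) (A B : 'M[R]_(m, p)) :
  \tr (A^T *m B) ^+ 2 <= \tr (A^T *m A) * \tr (B^T *m B).
Proof.
have key x y : 2 * (x * y * \tr (A^T *m B)) <=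
    x ^+ 2 * \tr (A^T *m A) + y ^+ 2 * \tr (B^T *m B).
  have := mxtrace_AMGM (x *: A) (y *: B).
  by rewrite ![(_ *: _)^T]linearZ/= -!scalemxAl -!scalemxAr !mxtraceZ !mulrA -!expr2.
have a0 := mxtrace_mul_tr_ge0 A; have b0 := mxtrace_mul_tr_ge0 B.
move: key a0 b0; set a := \tr (A^T *m A); set b := \tr (B^T *m B).
set y := \tr _ => key a0 b0.
have [b_eq0|b_neq0] := eqVneq b 0.
  have [->|y_neq0] := eqVneq y 0; first by rewrite expr0n mulr_ge0.
  (* With [b = 0], these scalars would give [a + 1 <= a]. *)
  have := key 1 ((a + 1) / (2 * y)); rewrite b_eq0 mulr0 addr0.
  have -> : 2 * (1 * ((a + 1) / (2 * y)) * y) = a + 1 by field.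
  by lra.
have b_gt0 : 0 < b by rewrite lt_neqAle eq_sym b_neq0.
rewrite -(ler_pM2l b_gt0); have := key b y; lra.
Qed.

Section quadratic_form.
Variables (R : realFieldType) (n : nat).
Implicit Types (A S : 'M[R]_n) (v : 'cV[R]_n).

(** Cauchy-Schwarz for [A] against the rank one matrix [y *m v^T], whose Frobenius product with [A]
    is the squared norm of [y]; one factor [|y|^2] then cancels. *)
Lemma mxtrace_mul_vec_le A v :
  \tr ((A *m v)^T *m (A *m v)) <= \tr (A^T *m A) * \tr (v^T *m v).
Proof.
set y := A *m v; have y0 := mxtrace_mul_tr_ge0 y.
have [->|y_neq0] := eqVneq (\tr (y^T *m y)) 0.
  by rewrite mulr_ge0// mxtrace_mul_tr_ge0.
have y_gt0 : 0 < \tr (y^T *m y) by rewrite lt_neqAle eq_sym y_neq0.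
have := mxtrace_CauchySchwarz A (y *m v^T).
have -> : \tr (A^T *m (y *m v^T)) = \tr (y^T *m y).
  by rewrite mulmxA mxtrace_mulC mulmxA -[in LHS]trmx_mul.
have -> : \tr ((y *m v^T)^T *m (y *m v^T)) = \tr (y^T *m y) * \tr (v^T *m v).
  rewrite trmx_mul trmxK -mulmxA. rewrite mxtrace_mulC mulmxA -(mulmxA (y^T *m y)).
  rewrite [y^T *m y]mx11_scalar [v^T *m v]mx11_scalar -scalar_mxM.
  by rewrite !mxtrace_scalar !mulr1n.
by rewrite expr2 mulrCA ler_pM2l.
Qed.

Lemma mxtrace_quad_cols m (A : 'M[R]_n) (W : 'M[R]_(n, m)) :
  \tr (W^T *m A *m W) = \sum_j \tr ((col j W)^T *m A *m col j W).
Proof.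
apply: eq_bigr => j _; rewrite trace_mx11 -mulmxA -[in RHS]mulmxA.
rewrite !mxE; apply: eq_bigr => i _; rewrite !mxE; congr (_ * _).
by apply: eq_bigr => k _; rewrite !mxE.
Qed.

Section moments.
Variables (S : 'M[R]_n) (v : 'cV[R]_n).
Hypotheses (Ssym : S^T = S) (v1 : \tr (v^T *m v) <= 1).

(** [a k] is the [k]-th moment of the spectral measure of [S ^+ 2] at [v]. Log-convexity of these
    moments takes the place of a diagonalization. *)
Let a k := \tr ((S ^+ k *m v)^T *m (S ^+ k *m v)).

Lemma moment_log_convex k : a k.+1 ^+ 2 <= a k * a k.+2.
Proof.
have := mxtrace_CauchySchwarz (S ^+ k *m v) (S ^+ k.+2 *m v).
suff -> : \tr ((S ^+ k *m v)^T *m (S ^+ k.+2 *m v)) = a k.+1 by [].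
rewrite /a !trmx_mul !trmxX Ssym -!mulmxA ![_ *m (_ *m v)]mulmxA !mulmxE.
by rewrite -(exprD S k k.+2) -(exprD S k.+1 k.+1) addSnnS.
Qed.

(** Log-convexity makes the ratios [a k.+1 / a k] nondecreasing, and the first of them is at least
    [a 1] because [a 0 <= 1]. *)
Lemma moment_ratio k : a 1%N * a k <= a k.+1.
Proof.
have a_ge0 j : 0 <= a j by exact: mxtrace_mul_tr_ge0.
have a0 : a 0%N <= 1 by rewrite /a expr0 mul1mx.
suff H : a 1%N * a k <= a 0%N * a k.+1.
  by rewrite (le_trans H)// -[leRHS]mul1r ler_wpM2r.
elim: k => [|k IH]; first by rewrite mulrC.
have [->|ak] := eqVneq (a k.+1) 0; first by rewrite mulr0 mulr_ge0.
have ak0 : 0 < a k.+1 by rewrite lt_neqAle eq_sym ak a_ge0.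
rewrite -(ler_pM2l ak0).
have h1 : a 1%N * a k.+1 ^+ 2 <= a 1%N * (a k * a k.+2).
  by rewrite ler_wpM2l// moment_log_convex.
have h2 : a 1%N * a k * a k.+2 <= a 0%N * a k.+1 * a k.+2 by rewrite ler_wpM2r.
nra.
Qed.

(** Iterating [moment_ratio] gives [a 1 ^+ p <= a p], and [a p] is at most the squared Frobenius
    norm of [S ^+ p], which is the trace of [S ^+ (2 * p)]. *)
Lemma mul_vec_pow_le_mxtrace p : (0 < p)%N ->
  \tr ((S *m v)^T *m (S *m v)) ^+ p <= \tr (S ^+ (2 * p)).
Proof.
move=> p0; have a_ge0 j : 0 <= a j by exact: mxtrace_mul_tr_ge0.
have -> : \tr ((S *m v)^T *m (S *m v)) = a 1%N by rewrite /a expr1.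
have h : a 1%N ^+ p <= a p.
  elim: p p0 => // -[|p] IH _; first by rewrite expr1.
  by rewrite exprS (le_trans _ (moment_ratio _))// ler_wpM2l// IH.
apply: (le_trans h); apply: (le_trans (mxtrace_mul_vec_le _ _)).
rewrite trmxX Ssym mulmxE -exprD addnn -mul2n -[leRHS]mulr1 ler_wpM2l//.
exact: mxtrace_expr2_ge0.
Qed.

End moments.
End quadratic_form.

(** * Trace bounds for the operator norm *)

Section opnorm.
Variable R : realType.

Lemma norm2_sqr_mxtrace n (v : 'cV[R]_n) : norm2 v ^+ 2 = \tr (v^T *m v).
Proof. by rewrite norm2_sqr mxtrace_mul_tr big_ord1. Qed.

Lemma norm2_ge0 n (v : 'cV[R]_n) : 0 <= norm2 v. Proof. exact: sqrtr_ge0. Qed.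

Lemma norm2Z n a (v : 'cV[R]_n) : norm2 (a *: v) = `|a| * norm2 v.
Proof.
apply/eqP; rewrite -(eqrXn2 (n := 2))// ?mulr_ge0 ?norm2_ge0//.
rewrite exprMn real_normK ?num_real// !norm2_sqr mulr_sumr.
by apply/eqP; apply: eq_bigr => i _; rewrite mxE exprMn.
Qed.

Lemma norm2_0 n : norm2 (0 : 'cV[R]_n) = 0.
Proof. by rewrite -(scale0r 0) norm2Z normr0 mul0r. Qed.

Lemma opnorm_le n (A : 'M[R]_n) c :
  (forall v, norm2 v <= 1 -> norm2 (A *m v) <= c) -> opnorm A <= c.
Proof.
move=> h; apply: ge_sup; last by move=> _ [v /= v1 <-]; exact: h.
by exists (norm2 (A *m 0)), 0 => //=; rewrite norm2_0.
Qed.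

Lemma norm2_mul_le_opnorm_ball n (A : 'M[R]_n) v :
  norm2 v <= 1 -> norm2 (A *m v) <= opnorm A.
Proof.
move=> v1; apply: ub_le_sup; last by exists v.
(* The supremum dominates its set only if the set is bounded; the Frobenius norm of [A] bounds
   it. *)
exists (Num.sqrt (\tr (A^T *m A))) => _ [u /= u1 <-].
rewrite -(ler_pXn2r (n := 2))// ?nnegrE ?norm2_ge0 ?sqrtr_ge0//.
rewrite norm2_sqr_mxtrace sqr_sqrtr ?mxtrace_mul_tr_ge0//.
apply: (le_trans (mxtrace_mul_vec_le _ _)).
rewrite -[leRHS]mulr1 ler_wpM2l ?mxtrace_mul_tr_ge0//.
by rewrite -norm2_sqr_mxtrace expr_le1 ?norm2_ge0.
Qed.

Lemma opnorm_ge0 n (A : 'M[R]_n) : 0 <= opnorm A.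
Proof.
by rewrite (le_trans (norm2_ge0 (A *m 0)))// norm2_mul_le_opnorm_ball ?norm2_0.
Qed.

Lemma norm2_mul_le_opnorm n (A : 'M[R]_n) v :
  norm2 (A *m v) <= opnorm A * norm2 v.
Proof.
have [v0|v0] := eqVneq (norm2 v) 0.
  rewrite v0 mulr0 -(ler_pXn2r (n := 2))// ?nnegrE ?norm2_ge0//.
  rewrite norm2_sqr_mxtrace (le_trans (mxtrace_mul_vec_le _ _))//.
  by rewrite -norm2_sqr_mxtrace v0 expr0n mulr0.
have v_gt0 : 0 < norm2 v by rewrite lt_neqAle eq_sym v0 norm2_ge0.
have := @norm2_mul_le_opnorm_ball _ A ((norm2 v)^-1 *: v).
rewrite -scalemxAr !norm2Z ger0_norm ?invr_ge0 ?norm2_ge0// mulVf// => /(_ (lexx _)).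
by rewrite mulrC ler_pdivrMr.
Qed.

(** Where [|S v| > L], one has [|S v| <= |S v|^(2p) / L^(2p-1)]. The free threshold [L] keeps the
    bound affine in the trace, so that its expectation can be taken without extracting a root. *)
Lemma opnorm_le_mxtrace n (S : 'M[R]_n) p L : S^T = S -> (0 < p)%N -> 0 < L ->
  opnorm S <= L + \tr (S ^+ (2 * p)) / L ^+ (2 * p).-1.
Proof.
move=> Ssym p0 L0; apply: opnorm_le => v v1.
have [rL|/ltW Lr] := leP (norm2 (S *m v)) L.
  by rewrite (le_trans rL)// lerDl divr_ge0 ?mxtrace_expr2_ge0// exprn_ge0// ltW.
apply: ler_wpDl; first exact: ltW.
rewrite ler_pdivlMr ?exprn_gt0//.
have := @mul_vec_pow_le_mxtrace _ _ S v Ssym _ p p0.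
rewrite -!norm2_sqr_mxtrace expr_le1 ?norm2_ge0// => /(_ v1).
rewrite -exprM; apply: le_trans.
rewrite -[in leRHS](@prednK (2 * p)) ?muln_gt0// exprS ler_wpM2l ?norm2_ge0//.
by rewrite lerXn2r ?nnegrE ?norm2_ge0// ltW.
Qed.

(** Cauchy-Schwarz column by column. Testing against [W] is the form that Loewner inequalities take
    below, where [W] is a power of a symmetric matrix. *)
Lemma mxtrace_quad_le_opnorm n m (A : 'M[R]_n) (W : 'M[R]_(n, m)) :
  \tr (W^T *m A *m W) <= opnorm A * \tr (W^T *m W).
Proof.
rewrite mxtrace_quad_cols -[in leRHS](mulmx1 W^T) mxtrace_quad_cols mulr_sumr.
apply: ler_sum => j _; rewrite mulmx1; set w := col j W.
have := mxtrace_CauchySchwarz w (A *m w).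
rewrite -!norm2_sqr_mxtrace mulmxA => h.
apply: le_trans (ler_norm _) _.
rewrite -(ler_pXn2r (n := 2))// ?nnegrE ?mulr_ge0 ?opnorm_ge0 ?sqr_ge0//.
rewrite real_normK ?num_real// (le_trans h)//.
rewrite exprMn mulrC [_ ^+ 2 ^+ 2]expr2 mulrA ler_wpM2r ?sqr_ge0//.
rewrite -exprMn lerXn2r ?nnegrE ?mulr_ge0 ?opnorm_ge0 ?norm2_ge0//.
all: by rewrite ?norm2_ge0 ?norm2_mul_le_opnorm.
Qed.

Lemma mxtrace_mul_le_opnorm n m (A : 'M[R]_n) (W : 'M[R]_(n, m)) :
  \tr ((A *m W)^T *m (A *m W)) <= opnorm A ^+ 2 * \tr (W^T *m W).
Proof.
rewrite trmx_mul mulmxA -[W^T *m A^T *m A]mulmxA mxtrace_quad_cols.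
rewrite -[in leRHS](mulmx1 W^T) mxtrace_quad_cols mulr_sumr.
apply: ler_sum => j _; rewrite mulmx1 -mulmxA -[in leLHS]mulmxA mulmxA -trmx_mul.
rewrite -!norm2_sqr_mxtrace -exprMn lerXn2r ?nnegrE ?mulr_ge0 ?opnorm_ge0 ?norm2_ge0//.
all: by rewrite ?norm2_ge0 ?norm2_mul_le_opnorm.
Qed.

Lemma mxtrace_le_opnorm n (A : 'M[R]_n) : \tr A <= n%:R * opnorm A.
Proof.
have := mxtrace_quad_le_opnorm A (1%:M : 'M[R]_n).
by rewrite trmx1 mul1mx !mulmx1 mxtrace1 mulrC.
Qed.

End opnorm.

Lemma mxtrace_sub_mul_tr_le (R : realFieldType) (m p : nat) (A B : 'M[R]_(m, p)) :
  \tr ((A - B)^T *m (A - B)) <= 2 * \tr (A^T *m A) + 2 * \tr (B^T *m B).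
Proof.
have := mxtrace_mul_tr_ge0 (A + B).
rewrite [(A - B)^T]linearB [(A + B)^T]linearD/= mulmxBl mulmxDl !mulmxBr !mulmxDr.
rewrite !raddfB/= !raddfD/=; lra.
Qed.

(** Combines [(A - B)^2 <= 2 A^2 + 2 B^2] with [(x x^T)^2 = |x|^2 x x^T]. The result is linear in
    [x x^T], so it can be summed over the sample and averaged. *)
Lemma mxtrace_rank1_sub_le (R : realType) n m (x : 'cV[R]_n) (Sg : 'M[R]_n)
    (W : 'M[R]_(n, m)) (M : R) : \tr (x^T *m x) <= M ->
  \tr (((x *m x^T - Sg) *m W)^T *m ((x *m x^T - Sg) *m W)) <=
  2 * M * \tr (W^T *m (x *m x^T) *m W) + 2 * opnorm Sg ^+ 2 * \tr (W^T *m W).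
Proof.
move=> xM; rewrite mulmxBl (le_trans (mxtrace_sub_mul_tr_le _ _))// lerD//; last first.
  by rewrite -mulrA ler_wpM2l// mxtrace_mul_le_opnorm.
have q0 : 0 <= \tr (W^T *m (x *m x^T) *m W).
  have := mxtrace_mul_tr_ge0 (x^T *m W).
  by rewrite trmx_mul trmxK !mulmxA.
rewrite -mulrA ler_wpM2l//.
suff -> : \tr ((x *m x^T *m W)^T *m (x *m x^T *m W)) =
    \tr (x^T *m x) * \tr (W^T *m (x *m x^T) *m W) by rewrite ler_wpM2r.
have -> : (x *m x^T *m W)^T *m (x *m x^T *m W) = W^T *m x *m (x^T *m x) *m x^T *m W.
  by rewrite !trmx_mul trmxK !mulmxA.
rewrite [x^T *m x]mx11_scalar mul_mx_scalar -!scalemxAl mxtraceZ trace_mx11 !mxE !mulr1n.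
by rewrite !mulmxA.
Qed.

(** * Moments of a sum of independent centered matrices *)

Section subalgebra.
Variables (R : realType) (T : Type).

(** An abstract class of random variables. Closure under the ring operations puts the entries of
    matrix polynomials in it, so the moment computation stays algebraic and integrability is checked
    once, for the concrete class. *)
Record subalgebra (A : (T -> R) -> Prop) : Prop := Subalgebra {
  subalg_cst : forall c, A (fun=> c) ;
  subalg_add : forall f g, A f -> A g -> A (fun t => f t + g t) ;
  subalg_mul : forall f g, A f -> A g -> A (fun t => f t * g t) }.

Record mean_on (A : (T -> R) -> Prop) (E : (T -> R) -> R) : Prop := MeanOn {
  mean_cst : forall c, E (fun=> c) = c ;
  mean_add : forall f g, A f -> A g -> E (fun t => f t + g t) = E f + E g ;
  mean_scale : forall c f, A f -> E (fun t => c * f t) = c * E f ;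
  mean_le : forall f g, A f -> A g -> (forall t, f t <= g t) -> E f <= E g }.

Variable (A : (T -> R) -> Prop).
Hypothesis Aalg : subalgebra A.

Definition entries_in p q (X : T -> 'M[R]_(p, q)) :=
  forall k l, A (fun t => X t k l).

Lemma subalg_sum (I : Type) (r : seq I) (f : I -> T -> R) :
  (forall i, A (f i)) -> A (fun t => \sum_(i <- r) f i t).
Proof.
move=> Af; elim: r => [|i r IH].
  by under eq_fun do rewrite big_nil; exact: subalg_cst.
by under eq_fun do rewrite big_cons; exact: subalg_add.
Qed.

Lemma entries_cst p q (X : 'M[R]_(p, q)) : entries_in (fun=> X).
Proof. by move=> k l; exact: subalg_cst. Qed.

Lemma entries_add p q (X Y : T -> 'M[R]_(p, q)) :
  entries_in X -> entries_in Y -> entries_in (fun t => X t + Y t).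
Proof.
by move=> AX AY k l; under eq_fun do rewrite mxE; exact: subalg_add.
Qed.

Lemma entries_sum p q (I : Type) (r : seq I) (X : I -> T -> 'M[R]_(p, q)) :
  (forall i, entries_in (X i)) -> entries_in (fun t => \sum_(i <- r) X i t).
Proof.
by move=> AX k l; under eq_fun do rewrite summxE; apply: subalg_sum => i; exact: AX.
Qed.

Lemma entries_mulmx p q r (X : T -> 'M[R]_(p, q)) (Y : T -> 'M[R]_(q, r)) :
  entries_in X -> entries_in Y -> entries_in (fun t => X t *m Y t).
Proof.
move=> AX AY k l; under eq_fun do rewrite mxE.
by apply: subalg_sum => i; exact: subalg_mul.
Qed.

Lemma entries_mul p (X Y : T -> 'M[R]_p) :
  entries_in X -> entries_in Y -> entries_in (fun t => X t * Y t).
Proof. exact: entries_mulmx. Qed.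

Lemma entries_exp p (X : T -> 'M[R]_p) k :
  entries_in X -> entries_in (fun t => X t ^+ k).
Proof.
move=> AX; elim: k => [|k IH].
  by under eq_fun do rewrite expr0; exact: entries_cst.
by under eq_fun do rewrite exprS; exact: entries_mul.
Qed.

Lemma entries_trmx p q (X : T -> 'M[R]_(p, q)) :
  entries_in X -> entries_in (fun t => (X t)^T).
Proof. by move=> AX k l; under eq_fun do rewrite mxE. Qed.

Lemma subalg_mxtrace p (X : T -> 'M[R]_p) : entries_in X -> A (fun t => \tr (X t)).
Proof. by move=> AX; apply: subalg_sum => i. Qed.

Variable E : (T -> R) -> R.
Hypothesis Emean : mean_on A E.

Lemma mean_sum (I : Type) (r : seq I) (f : I -> T -> R) :
  (forall i, A (f i)) -> E (fun t => \sum_(i <- r) f i t) = \sum_(i <- r) E (f i).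
Proof.
move=> Af; elim: r => [|i r IH].
  by under eq_fun do rewrite big_nil; rewrite big_nil (mean_cst Emean).
under eq_fun do rewrite big_cons.
by rewrite big_cons (mean_add Emean)// ?IH//; exact: subalg_sum.
Qed.

Definition meanmx p q (X : T -> 'M[R]_(p, q)) : 'M[R]_(p, q) :=
  \matrix_(k, l) E (fun t => X t k l).

Lemma mean_mxtrace_mull p (B : 'M[R]_p) (X : T -> 'M[R]_p) : entries_in X ->
  E (fun t => \tr (B * X t)) = \tr (B * meanmx X).
Proof.
move=> AX; rewrite mean_sum; last first.
  by move=> k; exact: (entries_mul (entries_cst B) AX).
apply: eq_bigr => k _; rewrite mxE; under eq_fun do rewrite mxE.
rewrite mean_sum; last by move=> l; apply: subalg_mul => //; exact: subalg_cst.
by apply: eq_bigr => l _; rewrite mxE (mean_scale Emean).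
Qed.

End subalgebra.

(** * Recursion for the even trace moments *)

Section trace_moments.
Local Open Scope set_scope.
Variables (R : realType) (T : Type) (N n : nat).
(** [alg J] stands for a class of functions of the [x i] with [i \in J]. Independence enters through
    [Eindep], as a factorization between one index and all the others. *)
Variables (alg : {set 'I_N} -> (T -> R) -> Prop) (E : (T -> R) -> R).
Hypothesis alg_sub : forall J, subalgebra (alg J).
Hypothesis alg_mono : forall J f, alg J f -> alg [set: 'I_N] f.
Hypothesis Emean : mean_on (alg [set: 'I_N]) E.
Hypothesis Eindep : forall i f g, alg [set i] f -> alg [set~ i] g ->
  E (fun t => f t * g t) = E f * E g.
Variables (x : 'I_N -> T -> 'cV[R]_n) (Sg : 'M[R]_n) (M : R).
Hypothesis x_in : forall i (J : {set 'I_N}), i \in J -> entries_in (alg J) (x i).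
Hypothesis xM : forall i t, \tr ((x i t)^T *m x i t) <= M.
Hypothesis x_cov : forall i, meanmx E (fun t => x i t *m (x i t)^T) = Sg.
Hypothesis Sg_le_M : opnorm Sg <= M.

Let Z i t := x i t *m (x i t)^T - Sg.
Let S t := \sum_i Z i t.
Let D i t := \sum_(j | j != i) Z j t.
Let s := opnorm Sg.

Let Zs i t : (Z i t)^T = Z i t.
Proof.
rewrite /Z linearB/= trmx_mul trmxK; congr (_ - _).
rewrite -(x_cov i); apply/matrixP => k l; rewrite !mxE; congr E.
by apply/funext => u; rewrite !mxE; apply: eq_bigr => j _; rewrite !mxE mulrC.
Qed.

Let Ds i t : (D i t)^T = D i t.
Proof. by rewrite /D raddf_sum; apply: eq_bigr => j _; exact: Zs. Qed.

Let Ss t : (S t)^T = S t.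
Proof. by rewrite /S raddf_sum; apply: eq_bigr => j _; exact: Zs. Qed.

Let SE i t : S t = D i t + Z i t.
Proof. by rewrite /S (bigD1 i)//= addrC. Qed.

Let outer_in i (J : {set 'I_N}) : i \in J ->
  entries_in (alg J) (fun t => x i t *m (x i t)^T).
Proof. by move=> iJ; apply: entries_mulmx => //; [|apply: entries_trmx]; exact: x_in. Qed.

Let Z_in i (J : {set 'I_N}) : i \in J -> entries_in (alg J) (Z i).
Proof. by move=> iJ; apply: entries_add => //; [exact: outer_in|exact: entries_cst]. Qed.

Let S_in : entries_in (alg [set: 'I_N]) S.
Proof. by apply: entries_sum => // i; apply: Z_in. Qed.

Let D_in i : entries_in (alg [set~ i]) (D i).
Proof.
have -> : D i = fun t => \sum_j (if j != i then Z j t else 0).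
  by apply/funext => t; rewrite /D big_mkcond.
apply: entries_sum => // j; have [ji|ji] := eqVneq j i; first exact: entries_cst.
by apply: Z_in; rewrite !inE.
Qed.

Let entries_mono J p q (X : T -> 'M[R]_(p, q)) :
  entries_in (alg J) X -> entries_in (alg [set: 'I_N]) X.
Proof. by move=> AX k l; apply: alg_mono (AX k l). Qed.

(** Independence, applied entry by entry, averages the first factor while the second stays
    random. *)
Let mean_indep_mxtrace i p (X Y : T -> 'M[R]_p) :
  entries_in (alg [set i]) X -> entries_in (alg [set~ i]) Y ->
  E (fun t => \tr (X t * Y t)) = E (fun t => \tr (meanmx E X * Y t)).
Proof.
move=> AX AY; rewrite (mean_mxtrace_mull (alg_sub _) Emean); last exact: entries_mono AY.
rewrite (mean_sum (alg_sub _) Emean); last first.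
  by move=> k; apply: entries_mulmx => //; [exact: entries_mono AX|exact: entries_mono AY].
apply: eq_bigr => k _; rewrite mxE; under eq_fun do rewrite mxE.
rewrite (mean_sum (alg_sub _) Emean); last first.
  by move=> l; apply: subalg_mul => //; [exact: alg_mono (AX _ _)|exact: alg_mono (AY _ _)].
by apply: eq_bigr => l _; rewrite !mxE (Eindep (AX _ _) (AY _ _)).
Qed.

Let mean_Z i : meanmx E (Z i) = 0.
Proof.
apply/matrixP => k l; rewrite !mxE /Z; under eq_fun do rewrite mxE.
rewrite (mean_add Emean); last by [exact: subalg_cst]; last first.
  by apply: outer_in.
by rewrite (mean_cst Emean) -(x_cov i) !mxE subrr.
Qed.

Let mean_Z_mul i (Y : T -> 'M[R]_n) : entries_in (alg [set~ i]) Y ->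
  E (fun t => \tr (Z i t * Y t)) = 0.
Proof.
move=> AY; rewrite (mean_indep_mxtrace _ AY); last by apply: Z_in; rewrite inE.
rewrite mean_Z; under eq_fun do rewrite mul0r linear0.
by rewrite (mean_cst Emean).
Qed.

Let tr_in (X : T -> 'M[R]_n) : entries_in (alg [set: 'I_N]) X ->
  alg [set: 'I_N] (fun t => \tr (X t)).
Proof. exact: subalg_mxtrace. Qed.

(** [mxtrace_Young] with tangent point [D i t]: the linear term contains [Z i], centered and
    independent of [D i], so it has mean zero. *)
Let D_jensen i h : (0 < h)%N ->
  E (fun t => \tr (D i t ^+ (2 * h))) <= E (fun t => \tr (S t ^+ (2 * h))).
Proof.
move=> h0.
have AD k : entries_in (alg [set~ i]) (fun t => D i t ^+ k).
  by apply: entries_exp.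
have AZD : entries_in (alg [set: 'I_N]) (fun t => Z i t * D i t ^+ (2 * h).-1).
  by apply: entries_mul => //; [apply: Z_in|apply: entries_mono (AD _)].
have -> : E (fun t => \tr (D i t ^+ (2 * h))) = E (fun t => \tr (D i t ^+ (2 * h)) +
    (2 * h)%:R * \tr (Z i t * D i t ^+ (2 * h).-1)).
  rewrite (mean_add Emean)//; last 2 first.
  - by apply: tr_in; exact: entries_mono (AD _).
  - by apply: subalg_mul => //; [exact: subalg_cst|exact: tr_in].
  by rewrite (mean_scale Emean) ?mean_Z_mul// ?mulr0 ?addr0//; exact: tr_in.
apply: (mean_le Emean).
- apply: subalg_add => //; first by apply: tr_in; exact: entries_mono (AD _).
  by apply: subalg_mul => //; [exact: subalg_cst|exact: tr_in].
- by apply: tr_in; exact: entries_exp.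
- move=> t; have := mxtrace_Young (Ss t) (Ds i t) h0.
  by have -> : S t - D i t = Z i t by rewrite (SE i) addrC addKr.
Qed.

Let M0 : 0 <= M. Proof. exact: le_trans (opnorm_ge0 Sg) Sg_le_M. Qed.

Let s0 : 0 <= s. Proof. exact: opnorm_ge0. Qed.

Let tr_sqr_mul (A B : 'M[R]_n) h : A^T = A -> B^T = B ->
  \tr (A * A * B ^+ (2 * h)) = \tr ((A *m B ^+ h)^T *m (A *m B ^+ h)).
Proof.
move=> As Bs; rewrite trmx_mul trmxX As Bs !mulmxE.
by rewrite mul2n -addnn exprD mulrA mxtraceC !mulrA.
Qed.

(** The mean of [(Z i)^2] is at most [2 M Sg + 2 s^2] in the Loewner order, hence at most [4 M s]
    because [s <= M]. *)
Let meanZ2_le i h : E (fun t => \tr (Z i t * Z i t * D i t ^+ (2 * h))) <=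
  4 * M * s * E (fun t => \tr (D i t ^+ (2 * h))).
Proof.
have AZ2 : entries_in (alg [set i]) (fun t => Z i t * Z i t).
  by apply: entries_mul => //; apply: Z_in; rewrite inE.
have AD k : entries_in (alg [set~ i]) (fun t => D i t ^+ k) by apply: entries_exp.
rewrite (mean_indep_mxtrace AZ2 (AD _)) -(mean_scale Emean); last first.
  by apply: tr_in; exact: entries_mono (AD _).
apply: (mean_le Emean).
- by apply: tr_in; apply: entries_mul => //; [exact: entries_cst|exact: entries_mono (AD _)].
- apply: subalg_mul => //; [exact: subalg_cst|].
  by apply: tr_in; exact: entries_mono (AD _).
(* Here [t] is frozen: [W] is a constant matrix, and the mean of the square of [Z i] is taken over a
   separate variable [u]. *)
move=> t; set W := D i t ^+ h.
have WW : D i t ^+ (2 * h) = W * W by rewrite mul2n -addnn exprD.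
have Ws : W^T = W by rewrite trmxX Ds.
rewrite mxtraceC WW -(mean_mxtrace_mull (alg_sub _) Emean); last exact: entries_mono AZ2.
have -> : \tr (W * W) = \tr (W^T *m W) by rewrite Ws.
have -> : 4 * M * s * \tr (W^T *m W) = 2 * M * (s * \tr (W^T *m W)) + 2 * M * (s * \tr (W^T *m W)).
  by ring.
have ww0 := mxtrace_mul_tr_ge0 W.
apply: (@le_trans _ _ (2 * M * \tr (W^T *m Sg *m W) + 2 * s ^+ 2 * \tr (W^T *m W))); last first.
  rewrite lerD//; first by rewrite ler_wpM2l ?mulr_ge0// mxtrace_quad_le_opnorm.
  by rewrite mulrA ler_wpM2r// expr2 mulrA ler_wpM2r// ler_wpM2l.
have AX : entries_in (alg [set: 'I_N]) (fun u => x i u *m (x i u)^T) by apply: outer_in.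
have -> : 2 * M * \tr (W^T *m Sg *m W) + 2 * s ^+ 2 * \tr (W^T *m W) =
    E (fun u => 2 * M * \tr (W * W * (x i u *m (x i u)^T)) + 2 * s ^+ 2 * \tr (W^T *m W)).
  have AW : entries_in (alg [set: 'I_N]) (fun u => W * W * (x i u *m (x i u)^T)).
    by apply: entries_mul => //; exact: entries_cst.
  rewrite (mean_add Emean); last 2 first.
  - by apply: subalg_mul => //; [exact: subalg_cst|exact: tr_in].
  - exact: subalg_cst.
  rewrite (mean_cst Emean) (mean_scale Emean); last exact: tr_in.
  rewrite (mean_mxtrace_mull (alg_sub _) Emean)// x_cov Ws.
  by rewrite -mulmxA mxtrace_mulC -mulmxA mxtrace_mulC.
apply: (mean_le Emean).
- apply: tr_in; apply: entries_mul => //; first exact: entries_cst.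
  exact: entries_mono AZ2.
- apply: subalg_add => //; last exact: subalg_cst.
  apply: subalg_mul => //; first exact: subalg_cst.
  by apply: tr_in; apply: entries_mul => //; exact: entries_cst.
move=> u; have := mxtrace_rank1_sub_le Sg W (xM i u).
rewrite -/(Z i u) -/s Ws.
have -> : \tr ((Z i u *m W)^T *m (Z i u *m W)) = \tr (W * W * (Z i u * Z i u)).
  by rewrite trmx_mul Ws Zs !mulmxE [RHS]mxtraceC -!mulrA [LHS]mxtraceC -!mulrA.
suff -> : \tr (W *m (x i u *m (x i u)^T) *m W) = \tr (W * W * (x i u *m (x i u)^T)) by [].
by rewrite !mulmxE [LHS]mxtraceC mulrA.
Qed.

(** After the rank one bounds are summed, the [x_i x_i^T] add up to [S + N Sg]. The part [S] raises
    the power by one; [2 M N Sg] and [2 N s^2] together give [4 M N s]. *)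
Let sumZ2_le h t : \sum_i \tr (Z i t * Z i t * S t ^+ (2 * h)) <=
  2 * M * \tr (S t ^+ (2 * h).+1) + 4 * M * N%:R * s * \tr (S t ^+ (2 * h)).
Proof.
set W := S t ^+ h.
have WW : S t ^+ (2 * h) = W * W by rewrite mul2n -addnn exprD.
have Ws : W^T = W by rewrite trmxX Ss.
have w0 := mxtrace_mul_tr_ge0 W.
apply: (@le_trans _ _ (\sum_i (2 * M * \tr (W^T *m (x i t *m (x i t)^T) *m W) +
    2 * s ^+ 2 * \tr (W^T *m W)))).
  by apply: ler_sum => i _; rewrite tr_sqr_mul// mxtrace_rank1_sub_le.
rewrite big_split/= -mulr_sumr sumr_const card_ord -raddf_sum/= -mulmx_suml -mulmx_sumr.
have -> : \sum_i (x i t *m (x i t)^T) = S t + N%:R *: Sg.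
  by rewrite /S /Z sumrB sumr_const card_ord scaler_nat subrK.
rewrite mulmxDr mulmxDl raddfD/= -scalemxAr -scalemxAl mxtraceZ.
have -> : \tr (W^T *m S t *m W) = \tr (S t ^+ (2 * h).+1).
  by rewrite Ws mxtrace_mulC mulmxA !mulmxE -WW -exprSr.
have -> : \tr (S t ^+ (2 * h)) = \tr (W^T *m W) by rewrite WW Ws.
have q := mxtrace_quad_le_opnorm Sg W.
have N0 : 0 <= N%:R :> R by [].
rewrite -mulr_natl mulrDr -addrA lerD2l.
have h1 : 2 * M * N%:R * \tr (W^T *m Sg *m W) <= 2 * M * N%:R * (s * \tr (W^T *m W)).
  by rewrite ler_wpM2l// !mulr_ge0.
have h2 : N%:R * (2 * s) * \tr (W^T *m W) * s <= N%:R * (2 * s) * \tr (W^T *m W) * M.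
  by rewrite ler_wpM2l// !mulr_ge0.
nra.
Qed.

Let moment_step h P : (h < P)%N ->
  E (fun t => \tr (S t ^+ (2 * h.+1))) <=
  (16 * P%:R ^+ 2 * M ^+ 2 + 32 * P%:R * M * N%:R * s) *
    E (fun t => \tr (S t ^+ (2 * h))).
Proof.
move=> hP.
have AS k : alg [set: 'I_N] (fun t => \tr (S t ^+ k)) by apply: tr_in; exact: entries_exp.
have AD i k : entries_in (alg [set~ i]) (fun t => D i t ^+ k) by apply: entries_exp.
have AZ i : entries_in (alg [set: 'I_N]) (Z i) by exact: Z_in.
have AZS i k : alg [set: 'I_N] (fun t => \tr (Z i t * S t ^+ k)).
  by apply: tr_in; apply: entries_mul => //; exact: entries_exp.
have AZD i k : alg [set: 'I_N] (fun t => \tr (Z i t * D i t ^+ k)).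
  by apply: tr_in; apply: entries_mul => //; exact: entries_mono (AD _ _).
have AZZS i k : alg [set: 'I_N] (fun t => \tr (Z i t * Z i t * S t ^+ k)).
  by apply: tr_in; apply: entries_mul => //; [exact: entries_mul|exact: entries_exp].
have AZZD i k : alg [set: 'I_N] (fun t => \tr (Z i t * Z i t * D i t ^+ k)).
  by apply: tr_in; apply: entries_mul => //; [exact: entries_mul|exact: entries_mono (AD _ _)].
set a := E (fun t => \tr (S t ^+ (2 * h))).
set b := E (fun t => \tr (S t ^+ (2 * h.+1))).
pose c := E (fun t => \tr (S t ^+ (2 * h).+1)).
have a0 : 0 <= a.
  rewrite -[leLHS](mean_cst Emean); apply: (mean_le Emean) => //; first exact: subalg_cst.
  by move=> t; exact: mxtrace_expr2_ge0.
(* The number of terms in the telescoping sum for the exponent [2h + 1]. *)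
pose k : R := (2 * h).+1%:R.
have k0 : 0 <= k by [].
have bE : b = \sum_i E (fun t => \tr (Z i t * S t ^+ (2 * h).+1)).
  rewrite -(mean_sum (alg_sub _) Emean)//; congr E; apply/funext => t.
  by rewrite -raddf_sum/= -mulr_suml -exprS mulnS.
have b_le i : E (fun t => \tr (Z i t * S t ^+ (2 * h).+1)) <=
    k * (E (fun t => \tr (Z i t * Z i t * S t ^+ (2 * h))) +
         E (fun t => \tr (Z i t * Z i t * D i t ^+ (2 * h)))).
  (* The zero added here is the mean of [tr (Z_i D_i^(2h+1))]; with it the inequality holds
     pointwise in [t]. *)
  rewrite -[leRHS]add0r -(mean_Z_mul (AD i (2 * h).+1)).
  rewrite -(mean_add Emean)// -(mean_scale Emean); last exact: subalg_add.
  rewrite -(mean_add Emean)//; last first.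
    by apply: subalg_mul => //; [exact: subalg_cst|exact: subalg_add].
  apply: (mean_le Emean) => //.
    apply: subalg_add => //; apply: subalg_mul => //; [exact: subalg_cst|exact: subalg_add].
  by move=> t; apply: mxtrace_mul_exprB.
have D_le i : E (fun t => \tr (Z i t * Z i t * D i t ^+ (2 * h))) <= 4 * M * s * a.
  rewrite (le_trans (meanZ2_le _ _))// ler_wpM2l ?mulr_ge0//.
  (* [D_jensen] asks for [0 < h]; at [h = 0] both traces are that of the identity. *)
  have [h_eq0|h0] := posnP h; last exact: D_jensen.
  suff -> : (fun t => \tr (D i t ^+ (2 * h))) = (fun t => \tr (S t ^+ (2 * h))) by [].
  by apply/funext => t; rewrite h_eq0 muln0 !expr0.
have S_le : \sum_i E (fun t => \tr (Z i t * Z i t * S t ^+ (2 * h))) <=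
    2 * M * c + 4 * M * N%:R * s * a.
  rewrite -(mean_sum (alg_sub _) Emean)// -!(mean_scale Emean)//.
  rewrite -(mean_add Emean); last 2 first.
  - by apply: subalg_mul => //; exact: subalg_cst.
  - by apply: subalg_mul => //; exact: subalg_cst.
  apply: (mean_le Emean); last exact: sumZ2_le.
  - exact: subalg_sum.
  - by apply: subalg_add => //; apply: subalg_mul => //; exact: subalg_cst.
(* The odd moment [c] is split between [b] and [a]. The scaling [2 k M] is chosen so that the term
   [2 k M c] of [b_tot] costs only half of [b], which is absorbed in [b_k]. *)
have c_le : 4 * k * M * c <= b + 4 * k ^+ 2 * M ^+ 2 * a.
  rewrite -!(mean_scale Emean)// -(mean_add Emean)//; last first.
    by apply: subalg_mul => //; exact: subalg_cst.
  apply: (mean_le Emean).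
  - by apply: subalg_mul => //; exact: subalg_cst.
  - by apply: subalg_add => //; apply: subalg_mul => //; exact: subalg_cst.
  move=> t; have := mxtrace_AMGM (S t ^+ h.+1) ((2 * k * M) *: S t ^+ h).
  rewrite [(_ *: _)^T]linearZ/= -!scalemxAl -!scalemxAr !mxtraceZ !trmxX Ss !mulmxE -!exprD.
  have -> : (h.+1 + h.+1 = 2 * h.+1)%N by lia.
  have -> : (h.+1 + h = (2 * h).+1)%N by lia.
  have -> : (h + h = 2 * h)%N by lia.
  lra.
have kP : k <= 2 * P%:R by rewrite /k -natrM ler_nat; lia.
have b_tot : b <= k * (2 * M * c + 8 * M * N%:R * s * a).
  rewrite bE (le_trans (ler_sum _ (fun i _ => b_le i)))// -mulr_sumr ler_wpM2l//.
  rewrite big_split/= (le_trans (lerD S_le (ler_sum _ (fun i _ => D_le i))))//.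
  by rewrite sumr_const card_ord -mulr_natl; lra.
have b_k : b <= (4 * k ^+ 2 * M ^+ 2 + 16 * k * M * N%:R * s) * a by lra.
rewrite (le_trans b_k)// ler_wpM2r// lerD//.
  rewrite ler_wpM2r ?sqr_ge0//.
  have : k ^+ 2 <= (2 * P%:R) ^+ 2 by rewrite lerXn2r ?nnegrE// mulr_ge0.
  by rewrite exprMn; lra.
rewrite -!mulrA; have : 0 <= M * (N%:R * s) by rewrite !mulr_ge0.
by nra.
Qed.

(** The factor in [moment_step] depends on [P] and not on [h], so the recursion iterates with one
    constant, starting from the trace [n] of the identity. *)
Lemma mean_mxtrace_moment_le P :
  E (fun t => \tr (S t ^+ (2 * P))) <=
  (16 * P%:R ^+ 2 * M ^+ 2 + 32 * P%:R * M * N%:R * s) ^+ P * n%:R.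
Proof.
set B := (X in X ^+ P * n%:R).
have B0 : 0 <= B by rewrite addr_ge0// !mulr_ge0 ?sqr_ge0.
suff H h : (h <= P)%N -> E (fun t => \tr (S t ^+ (2 * h))) <= B ^+ h * n%:R by exact: H.
elim: h => [|h IH] hP.
  rewrite muln0; under eq_fun do rewrite expr0 mxtrace1.
  by rewrite (mean_cst Emean) expr0 mul1r.
rewrite (le_trans (moment_step hP))// -/B exprS -(mulrA B) ler_wpM2l// IH//.
exact: ltnW.
Qed.

End trace_moments.

(** * Bounded functions of independent random variables *)

(* The sum is the integer part of [y / e]. *)
Lemma step_count (R : realFieldType) (y e : R) (L : nat) :
  0 < e -> 0 <= y -> y <= L%:R * e ->
  `|y - e * \sum_(l < L) (l.+1%:R * e <= y)%R%:R| <= e.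
Proof.
move=> e0 y0.
(* The induction on [L] drops [y <= L * e]: either all thresholds are passed, or the remainder is at
   most [e]. Recording that the count is an integer [k <= L] makes the induction go through. *)
suff H : e * \sum_(l < L) (l.+1%:R * e <= y)%R%:R <= y /\
    ((\sum_(l < L) (l.+1%:R * e <= y)%R%:R : R) = L%:R \/
     y <= e * \sum_(l < L) (l.+1%:R * e <= y)%R%:R + e /\
     (exists2 k, (k <= L)%N & (\sum_(l < L) (l.+1%:R * e <= y)%R%:R : R) = k%:R)).
  move=> yL; case: H => H1 H2.
  rewrite ler_norml; apply/andP; split; first by lra.
  by case: H2 => [->|[H2 _]]; lra.
elim: L => [|L [IH1 IH2]].
  by rewrite big_ord0 mulr0; split => //; left.
rewrite big_ord_recr/=.
have [yL|yL] := leP (L.+1%:R * e) y.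
  case: IH2 => [->|[IH2 [k kL kE]]].
    by rewrite natr1 mulrC; split => //; left.
  (* Passing the threshold [(L + 1) e] while [y <= (k + 1) e] forces [k = L]. *)
  rewrite kE in IH1 IH2 *.
  have := yL; rewrite -natr1 => yL'.
  have kLR : k%:R <= L%:R :> R by rewrite ler_nat.
  have kL' : k%:R * e <= L%:R * e by rewrite ler_pM2r.
  have yE : y = k%:R * e + e by lra.
  have LkE : L%:R * e = k%:R * e by lra.
  have Lk : L%:R = k%:R :> R by apply: (mulIf (lt0r_neq0 e0)).
  split; first by rewrite mulrDr mulr1; lra.
  by left; rewrite Lk.
rewrite addr0; split => //; right.
case: IH2 => [->|[IH2 [k kL kE]]].
  split; first by move: yL; rewrite -natr1; lra.
  by exists L.
by split => //; exists k => //; exact: leqW.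
Qed.

Section bounded_measurable.
Context d (T : measurableType d) (R : realType).

Definition bounded_measurable (f : T -> R) : Prop :=
  measurable_fun [set: T] f /\ exists c, forall x, `|f x| <= c.

Lemma measurable_subalgebra :
  subalgebra (fun f : T -> R => measurable_fun [set: T] f).
Proof.
split=> [c|f g mf mg|f g mf mg]; first exact: measurable_cst.
- exact: measurable_funD.
- exact: measurable_funM.
Qed.

Lemma bounded_measurable_subalgebra : subalgebra bounded_measurable.
Proof.
split=> [c|f g [mf [a fa]] [mg [b gb]]|f g [mf [a fa]] [mg [b gb]]].
- by split; [exact: measurable_cst|exists `|c|].
- split; first exact: measurable_funD.
  by exists (a + b) => x; rewrite (le_trans (ler_normD _ _))// lerD.
- split; first exact: measurable_funM.
  by exists (a * b) => x; rewrite normrM ler_pM.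
Qed.

Lemma bounded_measurable_indic (B : set T) : measurable B -> bounded_measurable \1_B.
Proof.
move=> mB; split; first exact: measurable_indic.
by exists 1 => x; rewrite indicE; case: (_ \in _); rewrite ?normr1 ?normr0.
Qed.

Lemma bounded_measurable_prod (I : finType) (f : I -> T -> R) :
  (forall i, bounded_measurable (f i)) ->
  bounded_measurable (fun t => \prod_i f i t).
Proof.
move=> bf; elim: index_enum => [|i r IH].
  under eq_fun do rewrite big_nil; exact: (subalg_cst bounded_measurable_subalgebra).
by under eq_fun do rewrite big_cons; exact: (subalg_mul bounded_measurable_subalgebra).
Qed.

Lemma bounded_measurable_integrable (P : probability T R) f :
  bounded_measurable f -> P.-integrable [set: T] (EFin \o f).
Proof.
move=> [mf [c fc]]; apply: measurable_bounded_integrable => //.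
  exact: le_lt_trans (probability_le1 P measurableT) (ltry 1).
by exists c; split; [exact: num_real|move=> y cy x _; exact: le_trans (fc x) (ltW cy)].
Qed.

Lemma Rintegral_mean_on (P : probability T R) :
  mean_on bounded_measurable (fun f => \int[P]_t f t).
Proof.
split=> [c|f g bf bg|c f bf|f g bf bg fg].
- by rewrite Rintegral_cst//; have := @probability_setT _ _ _ P => /= ->; rewrite mulr1.
- by rewrite RintegralD//; exact: bounded_measurable_integrable.
- by rewrite RintegralZl//; exact: bounded_measurable_integrable.
- by apply: le_Rintegral => //; exact: bounded_measurable_integrable.
Qed.

End bounded_measurable.

Lemma bounded_measurable_comp d d' (T : measurableType d) (T' : measurableType d')
    (R : realType) (f : T' -> R) (Y : T -> T') :
  bounded_measurable f -> measurable_fun [set: T] Y ->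
  bounded_measurable (fun t => f (Y t)).
Proof.
by move=> [mf [c fc]] mY; split; [exact: measurableT_comp|exists c => t; exact: fc].
Qed.

Lemma bounded_measurable_approx d (T : measurableType d) (R : realType)
    (f : T -> R) (e : R) : bounded_measurable f -> 0 < e ->
  exists L (B : 'I_L -> set T) (a b : R), (forall l, measurable (B l)) /\
    forall x, `|f x - (a + b * \sum_l \1_(B l) x)| <= e.
Proof.
(* [L] steps of height [e] cover the interval [[0, 2 |c|]], in which [f + |c|] takes its values. *)
move=> [mf [c fc]] e0; pose L := Num.bound (2 * `|c| / e).
exists L, (fun l : 'I_L => f @^-1` `[l.+1%:R * e - `|c|, +oo[%classic), (- `|c|), e.
split=> [l|x].
  by rewrite -[X in measurable X]setTI; exact: mf.
have fx : `|f x| <= `|c| by rewrite (le_trans (fc x))// ler_norm.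
have -> : f x -
    (- `|c| + e * \sum_(l < L) \1_(f @^-1` `[l.+1%:R * e - `|c|, +oo[%classic) x) =
    (f x + `|c|) - e * \sum_(l < L) (l.+1%:R * e <= f x + `|c|)%R%:R.
  rewrite opprD opprK addrA; congr (_ - _ * _); apply: eq_bigr => l _.
  rewrite indicE; congr (nat_of_bool _)%:R.
  by apply/idP/idP; rewrite inE/= in_itv/= andbT lerBlDr.
move: fx; rewrite ler_norml => /andP[fx1 fx2].
apply: step_count => //; first by lra.
have : 2 * `|c| / e < L%:R by apply: archi_boundP; rewrite divr_ge0 ?mulr_ge0// ltW.
by rewrite ltr_pdivrMr//; lra.
Qed.

Section independence.
Context d d0 (T : measurableType d) (T0 : measurableType d0) (R : realType).
Variable P : probability T R.

Let E (f : T -> R) : R := \int[P]_t f t.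
Let bm : subalgebra (@bounded_measurable _ T R) := @bounded_measurable_subalgebra _ T R.
Let Emean : mean_on (@bounded_measurable _ T R) E := Rintegral_mean_on P.

Lemma Rintegral_dist_le (f g : T -> R) e : bounded_measurable f -> bounded_measurable g ->
  (forall t, `|f t - g t| <= e) -> `|\int[P]_t f t - \int[P]_t g t| <= e.
Proof.
move=> bf bg fg; rewrite -/(E f) -/(E g) ler_norml; apply/andP; split.
  rewrite lerBrDl lerBlDr -[e](mean_cst Emean) -(mean_add Emean)//; last exact: subalg_cst.
  apply: (mean_le Emean) => //; first by apply: subalg_add => //; exact: subalg_cst.
  by move=> t; have := fg t; rewrite ler_norml => /andP[+ _]; lra.
rewrite lerBlDl -[e](mean_cst Emean) -(mean_add Emean)//; last exact: subalg_cst.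
apply: (mean_le Emean) => //; first by apply: subalg_add => //; exact: subalg_cst.
by move=> t; have := fg t; rewrite ler_norml => /andP[_]; lra.
Qed.

(** Both sides are linear in [f] and stable under uniform limits, and bounded measurable functions
    are uniform limits of step functions. *)
Lemma Rintegral_mul_indic_ext (Y : T -> T0) (W : T -> R) (c : R) :
  measurable_fun [set: T] Y -> bounded_measurable W ->
  (forall B, measurable B ->
    \int[P]_t (\1_B (Y t) * W t) = \int[P]_t \1_B (Y t) * c) ->
  forall f : T0 -> R, bounded_measurable f ->
    \int[P]_t (f (Y t) * W t) = \int[P]_t f (Y t) * c.
Proof.
move=> mY bW H f bf; have [_ [w Ww]] := bW.
have bfY := bounded_measurable_comp bf mY.
have b1 B : measurable B -> bounded_measurable (fun t => \1_B (Y t) : R).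
  by move=> mB; apply: (bounded_measurable_comp (bounded_measurable_indic R mB)).
(* The whole space as [B] identifies [c] with the mean of [W], which settles the constant term [a]
   of the step function. *)
have EW : E W = c.
  have := H _ measurableT; under eq_Rintegral do rewrite indicT mul1r.
  rewrite /E => ->; under eq_Rintegral do rewrite indicT.
  by have := mean_cst Emean 1; rewrite /E => ->; rewrite mul1r.
have w0 : 0 <= w by apply: le_trans (Ww point).
apply/eqP; rewrite -subr_eq0 -normr_le0; apply/ler_addgt0Pr => e e0; rewrite add0r.
(* The two approximation errors are [w e / K] and [|c| e / K]; adding 1 keeps [K] positive. *)
pose K := w + `|c| + 1.
have K0 : 0 < K by rewrite /K ltr_wpDl// addr_ge0.
have [L [B [a [b [mB gf]]]]] := bounded_measurable_approx bf (divr_gt0 e0 K0).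
pose g t := a + b * \sum_l \1_(B l) (Y t).
have bs : bounded_measurable (fun t => \sum_l \1_(B l) (Y t) : R).
  by apply: subalg_sum => // l; exact: b1.
have bg : bounded_measurable g.
  by apply: subalg_add => //; [exact: subalg_cst|apply: subalg_mul => //; exact: subalg_cst].
have gE : E (fun t => g t * W t) = E g * c.
  have -> : (fun t => g t * W t) = fun t => a * W t + b * \sum_l (\1_(B l) (Y t) * W t).
    by apply/funext => t; rewrite /g mulrDl -mulrA mulr_suml.
  have b1W l : bounded_measurable (fun t => \1_(B l) (Y t) * W t).
    by apply: subalg_mul => //; exact: b1.
  rewrite (mean_add Emean); last 2 first.
  - by apply: subalg_mul => //; exact: subalg_cst.
  - by apply: subalg_mul => //; [exact: subalg_cst|exact: subalg_sum].
  rewrite !(mean_scale Emean)//; last exact: subalg_sum.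
  rewrite /g (mean_add Emean); last 2 first.
  - exact: subalg_cst.
  - by apply: subalg_mul => //; exact: subalg_cst.
  rewrite (mean_cst Emean) (mean_scale Emean)// !(mean_sum bm Emean)//; last by move=> l; exact: b1.
  rewrite EW mulrDl -mulrA mulr_suml; congr (_ + _ * _).
  by apply: eq_bigr => l _; exact: H.
have h1 : `|E (fun t => f (Y t) * W t) - E (fun t => g t * W t)| <= e / K * w.
  apply: Rintegral_dist_le; [exact: subalg_mul|exact: subalg_mul|].
  by move=> t; rewrite -mulrBl normrM ler_pM// gf.
have h2 : `|E (fun t => f (Y t)) - E g| <= e / K.
  by apply: Rintegral_dist_le => // t; exact: gf.
have h3 : `|E g * c - E (fun t => f (Y t)) * c| <= e / K * `|c|.
  by rewrite -mulrBl normrM ler_wpM2r// distrC.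
rewrite -/(E (fun t => f (Y t) * W t)) -/(E (fun t => f (Y t))).
rewrite (le_trans (ler_distD (E g * c) _ _))// -{1}gE (le_trans (lerD h1 h3))//.
by rewrite -mulrDr mulrAC ler_pdivrMr// ler_pM2l// /K lerDl.
Qed.

End independence.

(** * Factorization for independent families *)

Section independent_family.
Context d d0 (T : measurableType d) (T0 : measurableType d0) (R : realType).
Variables (P : probability T R) (N : nat) (Y : 'I_N -> {RV P >-> T0}).
Hypothesis Yindep : mutually_independent Y.

Let E (f : T -> R) : R := \int[P]_t f t.
Let bm : subalgebra (@bounded_measurable _ T R) := @bounded_measurable_subalgebra _ T R.
Let bm0 : subalgebra (@bounded_measurable _ T0 R) := @bounded_measurable_subalgebra _ T0 R.
Let Emean : mean_on (@bounded_measurable _ T R) E := Rintegral_mean_on P.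

Let bounded_comp (f : T0 -> R) j : bounded_measurable f ->
  bounded_measurable (fun t => f (Y j t)).
Proof. by move=> bf; apply: bounded_measurable_comp. Qed.

Let Rintegral_indic (A : set T) : measurable A -> E (fun t => \1_A t) = fine (P A).
Proof. by move=> mA; rewrite /E /Rintegral integral_indic// setIT. Qed.

Let indep_indic (B : 'I_N -> set T0) : (forall j, measurable (B j)) ->
  E (fun t => \prod_j \1_(B j) (Y j t)) = \prod_j E (fun t => \1_(B j) (Y j t)).
Proof.
move=> mB.
have mYB j : measurable (Y j @^-1` B j) by exact: measurable_funPTI.
have -> : (fun t => \prod_j \1_(B j) (Y j t) : R) =
    \1_(\bigcap_(j in [set` finset.setTfor 'I_N]) (Y j @^-1` B j)).
  apply/funext => t; rewrite indicE; case: (asboolP (forall j, B j (Y j t))) => BY.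
    rewrite mem_set; last by move=> j _; exact: BY.
    by rewrite big1// => j _; rewrite indicE mem_set.
  rewrite memNset; last by move=> /= H; apply: BY => j; apply: H; rewrite /= inE.
  have [j Bj] : exists j, ~ B j (Y j t) by apply/existsNP.
  by rewrite (bigD1 j)//= indicE memNset// mul0r.
rewrite Rintegral_indic; last by apply: fin_bigcap_measurable.
rewrite (Yindep _ mB) -[RHS]/(fine (_%:E)) -prodEFin; congr fine.
apply: eq_big => [j|j _]; first by rewrite inE.
rewrite -[E _]/(E (fun t => \1_(Y j @^-1` B j) t)) Rintegral_indic//.
by rewrite fineK// fin_num_measure.
Qed.

(* Replace the indicators by bounded functions one coordinate at a time. *)
Lemma Rintegral_prod_indep (h : 'I_N -> T0 -> R) :
  (forall j, bounded_measurable (h j)) ->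
  \int[P]_t (\prod_j h j (Y j t)) = \prod_j \int[P]_t h j (Y j t).
Proof.
(* Coordinates from [k] on carry indicators: [k = 0] is [indep_indic], and [k = N] is the claim. *)
move=> bh; suff H k : (k <= N)%N -> forall h : 'I_N -> T0 -> R,
    (forall j, bounded_measurable (h j)) ->
    (forall j : 'I_N, (k <= j)%N -> exists2 B, measurable B & h j = \1_B) ->
    E (fun t => \prod_j h j (Y j t)) = \prod_j E (fun t => h j (Y j t)).
  by apply: (H N) => // j; rewrite leqNgt ltn_ord.
elim: k => [|k IH] kN {bh}h bh hB.
  have /choice[B hBE] : forall j, exists B, measurable B /\ h j = \1_B.
    by move=> j; have [B mB ->] := hB j isT; exists B.
  have -> : h = fun j => \1_(B j) by apply/funext => j; case: (hBE j).
  by rewrite indep_indic// => j; case: (hBE j).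
pose i := Ordinal kN.
pose W t := \prod_(j | j != i) h j (Y j t).
have bW : bounded_measurable W.
  have -> : W = fun t => \prod_j (if j != i then h j (Y j t) else 1).
    by apply/funext => t; rewrite /W big_mkcond.
  apply: bounded_measurable_prod => j.
  by case: (j != i); [exact: bounded_comp|exact: (subalg_cst bm)].
have -> : (fun t => \prod_j h j (Y j t)) = fun t => h i (Y i t) * W t.
  by apply/funext => t; rewrite (bigD1 i).
(* With the other factors collected in [W], it suffices to treat an indicator at coordinate [k], and
   there the induction hypothesis applies. *)
rewrite [RHS](bigD1 i)//=; apply: (Rintegral_mul_indic_ext _ bW _ (bh i)) => // B mB.
pose h' j := if j == i then \1_B else h j.
have h'E j : j != i -> h' j = h j by rewrite /h' => /negbTE ->.
have h'i : h' i = \1_B by rewrite /h' eqxx.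
have bh' j : bounded_measurable (h' j).
  by rewrite /h'; case: ifP => // _; exact: bounded_measurable_indic.
have h'B (j : 'I_N) : (k <= j)%N -> exists2 B, measurable B & h' j = \1_B.
  rewrite leq_eqVlt => /orP[/eqP kj|kj].
    have -> : j = i by apply/val_inj.
    by exists B.
  by rewrite h'E; [exact: hB|apply: contraTneq kj => ->; rewrite ltnn].
have := IH (ltnW kN) h' bh' h'B.
rewrite [RHS](bigD1 i)//= h'i.
have -> : (fun t => \prod_j h' j (Y j t)) = fun t => \1_B (Y i t) * W t.
  apply/funext => t; rewrite (bigD1 i)//= h'i; congr (_ * _).
  by apply: eq_bigr => j ji; rewrite h'E.
rewrite /E => ->; congr (_ * _); apply: eq_bigr => j ji; by rewrite h'E.
Qed.

(** The algebra spanned by products of functions of single coordinates, trivial outside [J]. It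
    contains the polynomials in the truncated samples, and [Rintegral_prod_indep] computes the means
    of its elements. *)
Definition generated_by (J : {set 'I_N}) (G : T -> R) : Prop :=
  exists (I : finType) (c : I -> R) (s : I -> 'I_N -> T0 -> R),
    [/\ forall a j, bounded_measurable (s a j),
        forall a j, j \notin J -> s a j = cst 1 &
        G = fun t => \sum_a c a * \prod_j s a j (Y j t)].

Lemma generated_by_subalgebra J : subalgebra (generated_by J).
Proof.
split.
- move=> c; exists unit, (fun=> c), (fun _ _ => cst 1); split => //.
    by move=> _ _; exact: (subalg_cst bm0).
  by apply/funext => t; rewrite big_const card_unit /= addr0 big1 ?mulr1.
- move=> _ _ [I [c [s [bs s1 ->]]]] [I' [c' [s' [bs' s'1 ->]]]].
  exists (I + I')%type, (fun a => match a with inl b => c b | inr b => c' b end),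
    (fun a => match a with inl b => s b | inr b => s' b end); split.
  + by case.
  + by case=> a j jJ; [exact: s1|exact: s'1].
  + by apply/funext => t; rewrite big_sumType.
- move=> _ _ [I [c [s [bs s1 ->]]]] [I' [c' [s' [bs' s'1 ->]]]].
  exists (I * I')%type, (fun a => c a.1 * c' a.2),
    (fun a j y => s a.1 j y * s' a.2 j y); split.
  + by move=> a j; exact: (subalg_mul bm0).
  + by move=> a j jJ; apply/funext => y; rewrite s1// s'1// mulr1.
  + apply/funext => t; rewrite big_distrlr/= pair_bigA; apply: eq_bigr => a _.
    by rewrite mulrACA big_split.
Qed.

Lemma generated_by_bounded J G : generated_by J G -> bounded_measurable G.
Proof.
move=> [I [c [s [bs _ ->]]]]; apply: subalg_sum => // a.
apply: subalg_mul => //; first exact: subalg_cst.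
by apply: bounded_measurable_prod => j; exact: bounded_comp.
Qed.

(** After expansion each coordinate carries a nontrivial factor from at most one side: at [j = i]
    the factor from [G] is 1, elsewhere the one from [F] is. The products of means therefore
    split. *)
Lemma generated_by_indep i F G :
  generated_by [set i]%SET F -> generated_by [set~ i]%SET G ->
  \int[P]_t (F t * G t) = \int[P]_t F t * \int[P]_t G t.
Proof.
move=> [I [c [s [bs s1 ->]]]] [I' [c' [s' [bs' s'1 ->]]]].
have bp (K : finType) (r : K -> 'I_N -> T0 -> R) :
    (forall a j, bounded_measurable (r a j)) ->
    forall a, bounded_measurable (fun t => \prod_j r a j (Y j t)).
  by move=> br a; apply: bounded_measurable_prod => j; exact: bounded_comp.
have Esum (K : finType) (k : K -> R) r : (forall a j, bounded_measurable (r a j)) ->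
    E (fun t => \sum_a k a * \prod_j r a j (Y j t)) =
    \sum_a k a * \prod_j E (fun t => r a j (Y j t)).
  move=> br; rewrite (mean_sum bm Emean); last first.
    by move=> a; apply: subalg_mul => //; [exact: subalg_cst|exact: bp].
  apply: eq_bigr => a _; rewrite (mean_scale Emean); last exact: bp.
  by rewrite /E Rintegral_prod_indep.
have -> : (fun t => (\sum_a c a * \prod_j s a j (Y j t)) *
      (\sum_a c' a * \prod_j s' a j (Y j t))) =
    fun t => \sum_(a : I * I') (c a.1 * c' a.2) *
      \prod_j (fun y => s a.1 j y * s' a.2 j y) (Y j t).
  apply/funext => t; rewrite big_distrlr/= pair_bigA; apply: eq_bigr => a _.
  by rewrite mulrACA big_split.
rewrite -![\int[_]__ _]/(E _) (Esum _ c)// (Esum _ c')//.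
rewrite (Esum _ (fun a : I * I' => c a.1 * c' a.2)
  (fun a j y => s a.1 j y * s' a.2 j y)); last by move=> a j; exact: subalg_mul.
rewrite big_distrlr/= pair_bigA; apply: eq_bigr => a _; rewrite mulrACA; congr (_ * _).
rewrite -big_split; apply: eq_bigr => j _; rewrite /E /=.
have [->|ji] := eqVneq j i.
  rewrite (s'1 a.2 i); last by rewrite !inE eqxx.
  under eq_Rintegral do rewrite mulr1.
  by rewrite -[X in _ = _ * X]/(E (fun=> 1)) (mean_cst Emean) mulr1.
rewrite (s1 a.1 j); last by rewrite inE.
under eq_Rintegral do rewrite mul1r.
by rewrite -[X in _ = X * _]/(E (fun=> 1)) (mean_cst Emean) mul1r.
Qed.

Lemma generated_by_comp (J : {set 'I_N}) i (f : T0 -> R) : i \in J ->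
  bounded_measurable f -> generated_by J (fun t => f (Y i t)).
Proof.
move=> iJ bf; exists unit, (fun=> 1), (fun _ j => if j == i then f else cst 1); split.
- by move=> _ j; case: ifP => // _; exact: (subalg_cst bm0).
- by move=> _ j jJ; case: eqP jJ => // ->; rewrite iJ.
- apply/funext => t; rewrite big_const card_unit /= addr0 mul1r (bigD1 i)//= eqxx.
  by rewrite big1 ?mulr1// => j /negbTE ->.
Qed.

Lemma generated_by_mono J G : generated_by J G -> generated_by [set: 'I_N]%SET G.
Proof.
by move=> [I [c [s [bs _ ->]]]]; exists I, c, s; split => // a j; rewrite inE.
Qed.

End independent_family.

(** * The sample covariance matrix *)

(* The integral of a nonnegative function is a supremum over simple functions,
   so it is monotone without measurability; this spares us a proof that the
   operator norm is measurable. *)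
Lemma ge0_le_integral_nonmeasurable d (T : measurableType d) (R : realType)
    (mu : {measure set T -> \bar R}) (f g : T -> \bar R) :
  (forall t, 0 <= f t)%E -> (forall t, f t <= g t)%E ->
  (\int[mu]_t f t <= \int[mu]_t g t)%E.
Proof.
move=> f0 fg; have g0 t : (0 <= g t)%E by exact: le_trans (fg t).
rewrite !ge0_integralTE//; apply: ereal_sup_le => _ [h /= hf <-].
by exists h => //= x; exact: le_trans (hf x) (fg x).
Qed.

Lemma mean_on_sub (R : realType) T (A B : (T -> R) -> Prop) E :
  (forall f, A f -> B f) -> mean_on B E -> mean_on A E.
Proof.
move=> AB [E1 E2 E3 E4]; split => // *; [apply: E2|apply: E3|apply: E4] => //; exact: AB.
Qed.

Lemma mxtrace_scale_exp (R : realFieldType) n (a : R) (A : 'M[R]_n) k :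
  \tr ((a *: A) ^+ k) = a ^+ k * \tr (A ^+ k).
Proof.
suff -> : (a *: A) ^+ k = a ^+ k *: A ^+ k by rewrite mxtraceZ.
elim: k => [|k IH]; first by rewrite !expr0 scale1r.
by rewrite !exprS IH -!mulmxE -scalemxAl -scalemxAr scalerA.
Qed.

(** * Transfer between identically distributed variables *)

Section same_law.
Context d d' d0 (T : measurableType d) (T' : measurableType d')
  (T0 : measurableType d0) (R : realType).
Variables (P : probability T R) (P' : probability T' R).
Variables (X : {RV P >-> T0}) (Y : {RV P' >-> T0}).
Hypothesis XY : identically_distributed X Y.

Lemma Rintegral_same_law (f : T0 -> R) : bounded_measurable f ->
  \int[P']_t f (Y t) = \int[P]_t f (X t).
Proof.
move=> bf.
have mf : measurable_fun [set: T0] (EFin \o f).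
  by apply/measurable_EFinP; case: bf.
have iX : P.-integrable [set: T] ((EFin \o f) \o X).
  by apply: bounded_measurable_integrable; exact: bounded_measurable_comp.
have iY : P'.-integrable [set: T'] ((EFin \o f) \o Y).
  by apply: bounded_measurable_integrable; exact: bounded_measurable_comp.
have := integral_distribution mf iX; have := integral_distribution mf iY.
rewrite /Rintegral /= => <- <-; congr fine.
by apply: eq_measure_integral => A mA _; exact: esym (XY mA).
Qed.

Lemma ae_same_law (A : set T0) : measurable A ->
  {ae P, forall t, A (X t)} -> {ae P', forall t, A (Y t)}.
Proof.
move=> mA aeX; have mAC := measurableC mA.
have X0 : P (X @^-1` ~` A) = 0%E.
  by apply: measure_negligible => //; exact: measurable_funPTI.
exists (Y @^-1` ~` A); split; [exact: measurable_funPTI| |by []].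
by rewrite -X0; have := XY mAC; rewrite /distribution /pushforward => ->.
Qed.

End same_law.

(** * Truncation to a ball *)

Section truncation.
Context (R : realType) (n : nat) (M : R).

Definition trunc_ball : set (n.-tuple R) := [set y | norm2 (colt y) ^+ 2 <= M].

(** The vector is set to zero outside the ball, so that the norm bound holds at every point, as [xM]
    demands in the moment computation. *)
Definition trunc_coord (k : 'I_n) (y : n.-tuple R) : R := \1_trunc_ball y * tnth y k.

Lemma measurable_trunc_ball : measurable trunc_ball.
Proof.
have mf : measurable_fun [set: n.-tuple R] (fun y => norm2 (colt y) ^+ 2).
  under eq_fun do rewrite norm2_sqr.
  apply: measurable_sum => i; apply: measurable_funX.
  by under eq_fun do rewrite mxE; exact: measurable_tnth.
have := mf measurableT _ (measurable_itv `]-oo, M]); rewrite setTI.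
by congr measurable; apply/seteqP; split => y; rewrite /trunc_ball /= in_itv.
Qed.

Lemma trunc_coordE k y : trunc_ball y -> trunc_coord k y = tnth y k.
Proof. by move=> By; rewrite /trunc_coord indicE mem_set// mul1r. Qed.

Lemma trunc_coord0 k y : ~ trunc_ball y -> trunc_coord k y = 0.
Proof. by move=> By; rewrite /trunc_coord indicE memNset// mul0r. Qed.

Lemma norm2_trunc_le y : 0 <= M -> \sum_k trunc_coord k y ^+ 2 <= M.
Proof.
move=> M0; have [By|By] := pselect (trunc_ball y).
  suff -> : \sum_k trunc_coord k y ^+ 2 = norm2 (colt y) ^+ 2 by [].
  by rewrite norm2_sqr; apply: eq_bigr => k _; rewrite mxE trunc_coordE.
by under eq_bigr do rewrite trunc_coord0// expr0n; rewrite big1.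
Qed.

Lemma bounded_measurable_trunc_coord k : bounded_measurable (trunc_coord k).
Proof.
split.
  apply: measurable_funM; last exact: measurable_tnth.
  by apply: measurable_indic; exact: measurable_trunc_ball.
(* [1 + |M|] dominates the square root of [|M|]. *)
exists (1 + `|M|) => y.
have h : trunc_coord k y ^+ 2 <= `|M|.
  have [By|By] := pselect (trunc_ball y); last by rewrite trunc_coord0// expr0n normr_ge0.
  have M0 : 0 <= M by apply: le_trans By; exact: sqr_ge0.
  rewrite (le_trans _ (ler_norm M))// (le_trans _ (norm2_trunc_le y M0))//.
  by rewrite (bigD1 k)//= lerDl sumr_ge0// => i _; exact: sqr_ge0.
rewrite -(ler_pXn2r (n := 2))// ?nnegrE ?addr_ge0// real_normK ?num_real//.
by rewrite (le_trans h)//; have := normr_ge0 M; nra.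
Qed.

End truncation.

(** * Moment bound for the sample covariance *)

Section sample_covariance.
Context (R : realType) (n : nat) (d d' : measure_display) (T : measurableType d)
  (T' : measurableType d').
Variables (P : probability T R) (P' : probability T' R).
Variables (X : {RV P >-> n.-tuple R}) (N : nat) (Y : 'I_N -> {RV P' >-> n.-tuple R}).
Variable M : R.
Hypothesis XM : {ae P, forall t, norm2 (colt (X t)) ^+ 2 <= M}.
Hypothesis copies : independent_copies X Y.
Hypothesis covM : opnorm (covmx X) <= M.
Hypothesis N0 : (0 < N)%N.

Let M0 : 0 <= M. Proof. exact: le_trans (opnorm_ge0 _) covM. Qed.

Let x i t : 'cV[R]_n := \col_k trunc_coord M k (Y i t).

Let mtnth k : measurable_fun [set: n.-tuple R] (fun y : n.-tuple R => tnth y k).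
Proof. exact: measurable_tnth. Qed.

(** Truncation changes [X] on a null set only, and each copy has the law of [X], so the covariance
    is preserved exactly. *)
Let trunc_covE i : meanmx (fun f : T' -> R => \int[P']_t f t)
  (fun t => x i t *m (x i t)^T) = covmx X.
Proof.
have [_ same] := copies.
apply/matrixP => k l; rewrite !mxE.
pose f y := trunc_coord M k y * trunc_coord M l y.
have bf : bounded_measurable f.
  apply: (subalg_mul (bounded_measurable_subalgebra _ _));
    exact: bounded_measurable_trunc_coord.
transitivity (\int[P]_t f (X t)).
  rewrite -(Rintegral_same_law (same i) bf); apply: eq_Rintegral => t _.
  by rewrite !mxE big_ord1 !mxE.
rewrite unlock /Rintegral; congr fine; apply: ae_eq_integral => //.
- apply/measurable_EFinP; apply: (measurableT_comp (f := f)) => //.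
  by case: bf.
- apply/measurable_EFinP; under eq_fun do rewrite !mxE big_ord1 !mxE.
  by apply: measurable_funM; exact: (measurableT_comp (mtnth _)).
- move: XM; apply: filterS => t Xt _.
  by rewrite !mxE big_ord1 !mxE /f !trunc_coordE.
Qed.

Lemma covmx_sym : (covmx X)^T = covmx X.
Proof.
apply/matrixP => k l; rewrite !mxE; congr (fine ('E_P[_]))%E.
by apply/funext => t; rewrite !mxE !big_ord1 !mxE mulrC.
Qed.

Let bound p : R := 16 * p%:R ^+ 2 * M ^+ 2 + 32 * p%:R * M * N%:R * opnorm (covmx X).

Lemma expectation_opnorm_le (p : nat) (L : R) : (0 < p)%N -> 0 < L ->
  ('E_P'[fun t => opnorm (sample_covmx (fun i => Y i t) - covmx X)%R] <=
   (L + bound p ^+ p * n%:R / N%:R ^+ (2 * p) / L ^+ (2 * p).-1)%:E)%E.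
Proof.
move=> p0 L0; have [Yindep same] := copies.
pose D t := sample_covmx (fun i => Y i t) - covmx X.
pose S t := \sum_i (x i t *m (x i t)^T - covmx X).
(* [F] involves the original samples, while [F'] uses the truncated ones and is bounded. They agree
   almost everywhere, since [D] is [S / N] there. *)
pose F t := L + \tr (D t ^+ (2 * p)) / L ^+ (2 * p).-1.
pose F' t := L + N%:R ^- (2 * p) * \tr (S t ^+ (2 * p)) / L ^+ (2 * p).-1.
have Dsym t : (D t)^T = D t.
  rewrite /D /sample_covmx linearB/= linearZ/= covmx_sym raddf_sum/=.
  by congr (_ *: _ - _); apply: eq_bigr => i _; rewrite trmx_mul trmxK.
(* Measurable functions also form a subalgebra, so the same closure lemmas yield the measurability
   of [F]. *)
pose ms := measurable_subalgebra T' R.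
have mD : entries_in (fun f : T' -> R => measurable_fun [set: T'] f) D.
  have -> : D = fun t =>
      (N%:R^-1)%:M *m (\sum_i (colt (Y i t) *m (colt (Y i t))^T)) + (- covmx X).
    by apply/funext => t; rewrite mul_scalar_mx.
  apply: (entries_add ms); last exact: (entries_cst ms).
  apply: (entries_mulmx ms); first exact: (entries_cst ms).
  apply: (entries_sum ms) => i.
  have mY : entries_in (fun f : T' -> R => measurable_fun [set: T'] f)
      (fun t => colt (Y i t)).
    by move=> k l; under eq_fun do rewrite mxE; exact: (measurableT_comp (mtnth k)).
  by apply: (entries_mulmx ms) => //; exact: entries_trmx.
have mF : measurable_fun [set: T'] F.
  apply: (subalg_add ms); first exact: (subalg_cst ms).
  apply: (subalg_mul ms); last exact: (subalg_cst ms).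
  by apply: (subalg_mxtrace ms); exact: (entries_exp ms).
pose alg := generated_by Y.
have asub J : subalgebra (alg J) by exact: generated_by_subalgebra.
have xin i (J : {set 'I_N}) : i \in J -> entries_in (alg J) (x i).
  move=> iJ k l; under eq_fun do rewrite mxE.
  by apply: generated_by_comp => //; exact: bounded_measurable_trunc_coord.
have Emean := @mean_on_sub R T' (alg [set: 'I_N]%SET) _ _
  (@generated_by_bounded _ _ _ _ _ _ _ Y _) (Rintegral_mean_on P').
have Sin : entries_in (alg [set: 'I_N]%SET) S.
  apply: entries_sum => // i; apply: entries_add => //; last exact: entries_cst.
  by apply: entries_mulmx => //; [|apply: entries_trmx]; apply: xin; rewrite inE.
have trSin : alg [set: 'I_N]%SET (fun t => \tr (S t ^+ (2 * p))).
  by apply: subalg_mxtrace => //; exact: entries_exp.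
have F'in : alg [set: 'I_N]%SET F'.
  apply: subalg_add => //; first exact: subalg_cst.
  apply: subalg_mul => //; last exact: subalg_cst.
  by apply: subalg_mul => //; exact: subalg_cst.
have bF' : bounded_measurable F' by exact: generated_by_bounded F'in.
have ES : \int[P']_t \tr (S t ^+ (2 * p)) <= bound p ^+ p * n%:R.
  apply: (@mean_mxtrace_moment_le R T' N n alg (fun f : T' -> R => \int[P']_t f t)) => //.
  - by move=> J f; exact: generated_by_mono.
  - by move=> i f g; exact: generated_by_indep.
  - move=> i t; rewrite -norm2_sqr_mxtrace norm2_sqr.
    by under eq_bigr do rewrite mxE; exact: norm2_trunc_le.
have aeY : {ae P', forall t, forall i, trunc_ball M (Y i t)}.
  apply: filter_forall => i.
  exact: (ae_same_law (same i) (@measurable_trunc_ball R n M) XM).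
rewrite unlock.
apply: (@le_trans _ _ (\int[P']_t (F t)%:E)%E).
  apply: ge0_le_integral_nonmeasurable => t; first by rewrite lee_fin opnorm_ge0.
  by rewrite lee_fin -/(D t) /F; apply: opnorm_le_mxtrace.
have -> : (\int[P']_t (F t)%:E = \int[P']_t (F' t)%:E)%E.
  apply: ae_eq_integral => //.
  - exact/measurable_EFinP.
  - by apply/measurable_EFinP; case: bF'.
  - move: aeY; apply: filterS => t Yt _; congr (_%:E); rewrite /F /F'.
    suff -> : D t = N%:R^-1 *: S t by rewrite mxtrace_scale_exp exprVn.
    rewrite /D /S sumrB sumr_const card_ord scalerBr -[X in _ - _ *: X]scaler_nat.
    rewrite scalerA mulVf ?pnatr_eq0 -?lt0n// scale1r; congr (_ *: _ - _).
    apply: eq_bigr => i _.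
    have -> : x i t = colt (Y i t) by apply/matrixP => k l; rewrite !mxE trunc_coordE.
    by [].
have -> : (\int[P']_t (F' t)%:E)%E = (\int[P']_t F' t)%:E.
  rewrite /Rintegral fineK//; apply: integrable_fin_num => //.
  exact: bounded_measurable_integrable.
rewrite lee_fin.
have -> : \int[P']_t F' t = L + N%:R ^- (2 * p) / L ^+ (2 * p).-1 *
    \int[P']_t \tr (S t ^+ (2 * p)).
  have -> : F' = fun t => L + N%:R ^- (2 * p) / L ^+ (2 * p).-1 * \tr (S t ^+ (2 * p)).
    by apply/funext => t; rewrite /F' mulrAC.
  rewrite (mean_add Emean); last 2 first.
  - exact: subalg_cst.
  - by apply: subalg_mul => //; exact: subalg_cst.
  by rewrite (mean_cst Emean) (mean_scale Emean).
rewrite lerD2l mulrC mulrA ler_wpM2r//; first by rewrite invr_ge0 exprn_ge0// ltW.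
by rewrite ler_wpM2r// invr_ge0 exprn_ge0.
Qed.

End sample_covariance.

(** * Choice of the exponent and conclusion *)

Lemma ln2_ge_half (R : realType) : 2^-1 <= ln 2 :> R.
Proof.
have h : ln (1 + - 2^-1) <= - 2^-1 :> R by apply: le_ln1Dx; lra.
have e : (1 + - 2^-1 : R) = 2^-1 by lra.
by move: h; rewrite e lnV ?posrE// lerN2.
Qed.

Lemma trunc_log2_le_ln (R : realType) n : (0 < n)%N ->
  (trunc_log 2 n)%:R <= 2 * ln n%:R :> R.
Proof.
move=> n0.
have : ln (2 ^+ trunc_log 2 n) <= ln n%:R :> R.
  by rewrite ler_ln ?posrE ?exprn_gt0 ?ltr0n// -natrX ler_nat trunc_logP.
rewrite lnXn// -[_ *+ trunc_log 2 n]mulr_natl.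
have : (trunc_log 2 n)%:R * 2^-1 <= (trunc_log 2 n)%:R * ln 2 :> R.
  by rewrite ler_wpM2l// ln2_ge_half.
lra.
Qed.

(** The chain is [b^p c <= (4 b)^p <= L^(2p)]. It serves for [c = n]: the dimension is absorbed once
    [p] is of the order of [log n]. *)
Lemma moment_tail_le (R : realFieldType) (b L c : R) (p : nat) : (0 < p)%N ->
  0 < L -> 0 <= b -> 4 * b <= L ^+ 2 -> c <= 4 ^+ p ->
  b ^+ p * c / L ^+ (2 * p).-1 <= L.
Proof.
move=> p0 L0 b0 bL cp; rewrite ler_pdivrMr ?exprn_gt0// -exprS prednK ?muln_gt0//.
rewrite (le_trans (ler_wpM2l (exprn_ge0 _ b0) cp))// -exprMn exprM.
apply: lerXn2r; last by rewrite mulrC.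
all: by rewrite nnegrE ?sqr_ge0 ?mulr_ge0.
Qed.

Theorem theorem3p1p2 (R : realType) (K : R) (hK : 1 <= K) :
  exists C : R, 0 < C /\
    forall (n : nat) (d : measure_display) (T : measurableType d)
      (P : probability T R) (X : {RV P >-> n.-tuple R}),
      (1 < n)%N ->
      square_integrable X ->
      mean_zero X ->
      {ae P, forall t, ((norm2 (colt (X t)) ^+ 2)%:E <=
        K%:E * 'E_P[fun s => (norm2 (colt (X s)) ^+ 2)%R])%E} ->
      forall (N : nat) (d' : measure_display) (T' : measurableType d')
        (P' : probability T' R) (Y : 'I_N -> {RV P' >-> n.-tuple R}),
        (0 < N)%N ->
        independent_copies X Y ->
        ('E_P'[fun t => opnorm (sample_covmx (fun i => Y i t) - covmx X)%R] <=
         (C * opnorm (covmx X) *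
            (Num.sqrt (n%:R * ln n%:R / N%:R) + n%:R * ln n%:R / N%:R))%:E)%E.
Proof.
have K0 : 0 < K by lra.
have K_ge0 := ltW K0.
(* Here [32 = 2 * 16]: the threshold [L] below is [16 K s (q + u)] up to a small slack, and the
   moment term contributes at most [L] again. *)
exists (32 * K); split; first by lra.
move=> n d T P X n1 X2 _ XK N d' T' P' Y N0 copies.
set s := opnorm (covmx X); have s0 : 0 <= s by exact: opnorm_ge0.
(* This dominates [K tr Sigma], because the trace is at most [n s]. *)
pose M := K * n%:R * s.
have n1R : 1 <= n%:R :> R by rewrite ler1n ltnW.
have sM : s <= M.
  by rewrite /M -[leLHS]mul1r ler_wpM2r// -[leLHS]mulr1 ler_pM.
have M0 : 0 <= M by exact: le_trans s0 sM.
have XM : {ae P, forall t, norm2 (colt (X t)) ^+ 2 <= M}.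
  move: XK; apply: filterS => t; rewrite expectation_norm2// -EFinM lee_fin => h.
  by rewrite (le_trans h)// /M -mulrA ler_pM2l// mxtrace_le_opnorm.
(* Since [1 < n], the exponent is at least 1, and therefore [n < 2^(p+1) <= 4^p]. *)
pose p := trunc_log 2 n.
have p0 : (0 < p)%N by rewrite trunc_log_gt0.
have p_le : p%:R <= 2 * ln n%:R :> R by apply: trunc_log2_le_ln; exact: ltnW.
have n_le : n%:R <= 4 ^+ p :> R.
  rewrite -natrX ler_nat (@leq_trans (2 ^ p.+1))//; first by rewrite ltnW// trunc_log_ltn.
  by rewrite -[4%N]/(2 ^ 2)%N -expnM leq_exp2l//; lia.
have NR : 0 < N%:R :> R by rewrite ltr0n.
have p1 : 1 <= p%:R :> R by rewrite ler1n.
set u := n%:R * ln n%:R / N%:R.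
have ln0 : 0 <= ln n%:R :> R by rewrite ln_ge0.
have u0 : 0 <= u by rewrite divr_ge0// mulr_ge0.
set q := Num.sqrt u.
have q0 : 0 <= q by exact: sqrtr_ge0.
have qq : q ^+ 2 = u by rewrite sqr_sqrtr.
(* The slack [e] keeps [L] positive even when [s = 0]; [L] receives only [e / 2] because it is
   counted twice. *)
apply/lee_addgt0Pr => e e0; rewrite -EFinD.
pose L := 16 * K * s * (q + u) + e / 2.
have L0 : 0 < L by rewrite ltr_wpDl ?divr_gt0// !mulr_ge0 ?addr_ge0.
apply: (le_trans (expectation_opnorm_le XM copies sM N0 p0 L0)).
rewrite lee_fin.
set B := (X in X ^+ p * _).
have B0 : 0 <= B.
  by rewrite /B -/s addr_ge0 ?mulr_ge0 ?sqr_ge0.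
pose b := B / N%:R ^+ 2.
have b0 : 0 <= b by rewrite divr_ge0// sqr_ge0.
have -> : B ^+ p * n%:R / N%:R ^+ (2 * p) = b ^+ p * n%:R.
  by rewrite /b exprMn exprVn -exprM mulrAC.
have bL : 4 * b <= L ^+ 2.
  apply: (@le_trans _ _ ((16 * K * s * (q + u)) ^+ 2)); last first.
    apply: lerXn2r; rewrite ?nnegrE ?(ltW L0)//; first by rewrite !mulr_ge0 ?addr_ge0.
    by rewrite lerDl divr_ge0// ltW.
  (* In terms of [v] the recursion factor over [N^2] is [(16 v^2 K^2 + 32 v K) s^2]; then
     [v <= 2 u], [K <= K^2] and [q^2 = u] bring it below [64 K^2 (q + u)^2 s^2]. *)
  pose v := p%:R * n%:R / N%:R : R.
  have v0 : 0 <= v by rewrite divr_ge0// mulr_ge0.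
  have vu : v <= 2 * u.
    by rewrite /v /u mulrA ler_pM2r ?invr_gt0// mulrCA mulrC ler_wpM2l.
  have bE : b = (16 * v ^+ 2 * K ^+ 2 + 32 * v * K) * s ^+ 2.
    by rewrite /b /B -/s /M /v; field; rewrite gt_eqF.
  have v2 : v ^+ 2 <= 4 * u ^+ 2.
    have : v ^+ 2 <= (2 * u) ^+ 2 by apply: lerXn2r; rewrite ?nnegrE ?mulr_ge0.
    lra.
  have KK : K <= K ^+ 2 by rewrite expr2 ler_peMr// ltW.
  have h1 : 16 * v ^+ 2 * K ^+ 2 + 32 * v * K <= 64 * K ^+ 2 * (q + u) ^+ 2.
    have h2 : v ^+ 2 * K ^+ 2 <= 4 * u ^+ 2 * K ^+ 2 by rewrite ler_wpM2r ?sqr_ge0.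
    have h3 : v * K <= 2 * u * K ^+ 2 by rewrite ler_pM// ltW.
    have h4 : 0 <= K ^+ 2 * (q * u) by rewrite !mulr_ge0 ?sqr_ge0.
    have -> : (q + u) ^+ 2 = u + 2 * (q * u) + u ^+ 2 by rewrite -qq; ring.
    lra.
  rewrite bE.
  have : (16 * v ^+ 2 * K ^+ 2 + 32 * v * K) * s ^+ 2 <=
      64 * K ^+ 2 * (q + u) ^+ 2 * s ^+ 2 by rewrite ler_wpM2r ?sqr_ge0.
  lra.
have := moment_tail_le p0 L0 b0 bL n_le.
rewrite /L; lra.
Qed.
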